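(* Let $n\ge2$, let $\alpha,\beta\in\mathbb R^n$ both have pairwise distinct coordinates, and let $J=D\Omega(\alpha,\beta):\mathbb R^{2n}\to\mathbb R^n$. Let $\mathcal V=\mathbf 1_n^\perp\oplus\mathbf 1_n^\perp\subset\mathbb R^{2n}$. The restriction $J|_{\mathcal V}$ has operator norm $1$ (Euclidean norms), and its singular value $1$ is simple. More precisely, $$\ker\bigl(I_{\mathcal V}-(J|_{\mathcal V})^*(J|_{\mathcal V})\bigr)=\operatorname{span}\{\alpha^\circ\oplus\beta^\circ\}.$$
   Context: Finite free additive convolution: for $p(x)=\sum_{k=0}^n(-1)^ka_kx^{n-k}$ and $q(x)=\sum_{k=0}^n(-1)^kb_kx^{n-k}$ with $a_0=b_0=1$, set $(p\boxplus_n q)(x)=\sum_{k=0}^n(-1)^kc_kx^{n-k}$ with $c_k=\sum_{i+j=k}\frac{(n-i)!(n-j)!}{n!(n-k)!}a_ib_j$. If $p,q$ are real-rooted, so is $p\boxplus_nq$ (Walsh), and if moreover one of them has simple roots then $p\boxplus_nq$ has simple roots (Fujie). For $\alpha\in\mathbb R^n$, $P_\alpha(x)=\prod_{i=1}^n(x-\alpha_i)$. $\Omega(\alpha,\beta)\in\mathbb R^n$ is the vector of roots of $P_\alpha\boxplus_nP_\beta$ listed in increasing order; where the output is simple, $\Omega$ is real analytic on an open subset of $\mathbb R^{2n}$ and $D\Omega$ is its full Jacobian. $\mathbf 1_n$ is the all-ones vector; for $\rho\in\mathbb R^n$, $\rho^\circ=\rho-\bar\rho\,\mathbf 1_n$ with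 $\bar\rho=\frac1n\sum_i\rho_i$. *)

(* Defs.v *)
From HB Require Import structures.
From mathcomp Require Import all_boot all_order all_algebra.
From mathcomp Require Import all_classical all_reals all_analysis.

Set Implicit Arguments.
Unset Strict Implicit.
Unset Printing Implicit Defensive.

Import Order.TTheory GRing.Theory Num.Theory.
Import numFieldNormedType.Exports.

Local Open Scope ring_scope.
Local Open Scope classical_set_scope.

Section FreeConvolution.
Variable R : realType.
Implicit Types p q : {poly R}.

(* [acoef n p k] is the a_k of p = \sum_(k <= n) (-1)^k a_k X^(n-k). *)
Definition acoef n p (k : nat) : R := (-1) ^+ k * p`_(n - k).

Definition boxplus_coef n p q (k : nat) : R :=
  \sum_(i < k.+1)
    ((n - i)`! * (n - (k - i))`!)%:R / (n`! * (n - k)`!)%:R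
      * (acoef n p i * acoef n q (k - i)).

Definition boxplus n p q : {poly R} :=
  \sum_(k < n.+1) ((-1) ^+ k * boxplus_coef n p q k) *: 'X^(n - k).

Definition rpoly n (a : 'rV[R]_n) : {poly R} := \prod_(i < n) ('X - (a 0 i)%:P).

(* Roots are listed with multiplicity; the value is the junk vector 0 when [p]
   is not a monic real-rooted polynomial of degree [n]. *)
Definition ordered_roots n p : 'rV[R]_n :=
  xget 0 [set w : 'rV[R]_n |
    (forall i j : 'I_n, (i <= j)%N -> w 0 i <= w 0 j) /\ p = rpoly w].

Lemma ordered_rootsP n p (w : 'rV[R]_n) :
  (forall i j : 'I_n, (i <= j)%N -> w 0 i <= w 0 j) -> p = rpoly w ->
  ordered_roots n p = w.
Proof.
move=> wS pw; apply: xget_unique => //= v [vS pv].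
pose s (u : 'rV[R]_n) := [seq u 0 i | i <- enum 'I_n].
have sP (u : 'rV[R]_n) : rpoly u = \prod_(x <- s u) ('X - x%:P).
  by rewrite big_map big_enum.
have sS (u : 'rV[R]_n) : (forall i j : 'I_n, (i <= j)%N -> u 0 i <= u 0 j) ->
    sorted <=%O (s u).
  move=> uS; have le_sorted : sorted (fun i j : 'I_n => (i <= j)%N) (enum 'I_n).
    by have := iota_sorted 0 n; rewrite -val_enum_ord sorted_map.
  by rewrite sorted_map; apply: sub_sorted le_sorted => i j; apply: uS.
have vw : s v = s w.
  apply: (sorted_eq le_trans le_anti (sS v vS) (sS w wS)).
  by apply: prod_XsubC_eq; rewrite -!sP -pv -pw.
apply/rowP => i; move/eq_in_map: vw => /(_ i); apply; exact: mem_enum.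
Qed.

Definition Omega n (a b : 'rV[R]_n) : 'rV[R]_n :=
  ordered_roots n (boxplus n (rpoly a) (rpoly b)).

(* R^(2n) is 'rV_(n + n), a pair (a, b) being [row_mx a b]. The ambient norm of
   the differential is the sup norm, which does not affect its value. *)
Definition DOmega n (a b : 'rV[R]_n) : 'Hom('rV[R]_(n + n), 'rV[R]_n) :=
  linfun ('d (fun x : 'rV[R]_(n + n) => Omega (lsubmx x) (rsubmx x))
             (row_mx a b)).

End FreeConvolution.

Section Euclidean.
Variable R : realType.

Definition dot m (u v : 'rV[R]_m) : R := \sum_(i < m) u 0 i * v 0 i.

Definition enorm m (u : 'rV[R]_m) : R := Num.sqrt (dot u u).

Definition perp m (u : 'rV[R]_m) : {vspace 'rV[R]_m} :=
  lker (linfun (mulmxr u^T)).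

Lemma memv_perp m (u v : 'rV[R]_m) : (v \in perp u) = (dot v u == 0).
Proof.
rewrite memv_ker lfunE /=; apply/eqP/eqP => [/matrixP/(_ 0 0)|uv].
  by rewrite !mxE => <-; apply: eq_bigr => i _; rewrite mxE.
apply/matrixP => i j; rewrite !mxE !ord1 -[RHS]uv.
by apply: eq_bigr => k _; rewrite mxE.
Qed.

Definition dsumv m k (U : {vspace 'rV[R]_m}) (W : {vspace 'rV[R]_k}) :
    {vspace 'rV[R]_(m + k)} :=
  (linfun lsubmx @^-1: U :&: linfun rsubmx @^-1: W)%VS.

Lemma memv_dsumv m k (U : {vspace 'rV[R]_m}) (W : {vspace 'rV[R]_k}) u w :
  (row_mx u w \in dsumv U W) = (u \in U) && (w \in W).
Proof.
by rewrite memv_cap -!memv_preim !lfunE /= row_mxKl row_mxKr.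
Qed.

Definition lrestr m k (f : 'Hom('rV[R]_m, 'rV[R]_k)) (U : {vspace 'rV[R]_m}) :
    'Hom(subvs_of U, 'rV[R]_k) :=
  (f \o linfun vsval)%VF.

Section Subspace.
Variables (m k : nat) (U : {vspace 'rV[R]_m}) (f : 'Hom(subvs_of U, 'rV[R]_k)).

(* Hilbert adjoint, [U] carrying the inner product induced by 'rV_m. *)
Definition adjoint : 'Hom('rV[R]_k, subvs_of U) :=
  xget 0 [set g : 'Hom('rV[R]_k, subvs_of U) |
    forall v w, dot (f v) w = dot (vsval v) (vsval (g w))].

Definition opnorm : R :=
  sup [set enorm (f v) | v in [set v : subvs_of U | enorm (vsval v) <= 1]].

(* Multiplicity of [s >= 0] as a singular value of [f]. *)
Definition singular_mult (s : R) : nat :=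
  \dim (passmx.leigenspace (adjoint \o f)%VF (s ^+ 2)).

End Subspace.

Lemma dot_linear m (u : 'rV[R]_m) : linear (dot u : _ -> R^o).
Proof.
move=> a v w; rewrite /dot scaler_sumr -big_split; apply: eq_bigr => i _ /=.
by rewrite !mxE mulrDr mulrCA.
Qed.

Lemma dotC m (u v : 'rV[R]_m) : dot u v = dot v u.
Proof. by apply: eq_bigr => i _; rewrite mulrC. Qed.

Lemma dot_eq0 m (u : 'rV[R]_m) : (dot u u == 0) = (u == 0).
Proof.
apply/eqP/eqP => [u0|->]; last by rewrite /dot big1// => i _; rewrite mxE mul0r.
apply/rowP => i; rewrite mxE; apply/eqP; rewrite -[_ == _]orbb -mulf_eq0.
apply/eqP; move: u0 => /psumr_eq0P; apply => // j _.
by rewrite -expr2 sqr_ge0.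
Qed.

Lemma adjointP m k (U : {vspace 'rV[R]_m}) (f : 'Hom(subvs_of U, 'rV[R]_k)) v w :
  dot (f v) w = dot (vsval v) (vsval (adjoint f w)).
Proof.
suff [g gP] : exists g : 'Hom('rV[R]_k, subvs_of U),
    forall v w, dot (f v) w = dot (vsval v) (vsval (g w)).
  exact: (xgetPex 0 (P := [set g : 'Hom('rV[R]_k, subvs_of U) |
    forall v w, dot (f v) w = dot (vsval v) (vsval (g w))])
    (ex_intro _ g gP)).
pose b := vbasis {: subvs_of U}.
pose d := \dim {: subvs_of U}.
pose phi0 (u : subvs_of U) : 'rV[R]_d := \row_i dot (vsval b`_i) (vsval u).
have phi0L : linear phi0.
  by move=> a x y; apply/rowP => i; rewrite !mxE linearP dot_linear.
pose phi : 'Hom(subvs_of U, 'rV[R]_d) :=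
  linfun (HB.pack phi0 (GRing.isLinear.Build _ _ _ _ _ phi0L)
            : {linear _ -> _}).
have phiE u : phi u = phi0 u by rewrite lfunE.
pose psi0 (w : 'rV[R]_k) : 'rV[R]_d := \row_i dot (f b`_i) w.
have psi0L : linear psi0.
  by move=> a x y; apply/rowP => i; rewrite !mxE dot_linear.
pose psi : 'Hom('rV[R]_k, 'rV[R]_d) :=
  linfun (HB.pack psi0 (GRing.isLinear.Build _ _ _ _ _ psi0L)
            : {linear _ -> _}).
have psiE u : psi u = psi0 u by rewrite lfunE.
have extd (h1 h2 : subvs_of U -> R^o) : linear h1 -> linear h2 ->
    (forall i : 'I_d, h1 b`_i = h2 b`_i) -> h1 =1 h2.
  move=> h1L h2L h12 u.
  pose H1 : {linear _ -> _} := HB.pack h1 (GRing.isLinear.Build _ _ _ _ _ h1L).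
  pose H2 : {linear _ -> _} := HB.pack h2 (GRing.isLinear.Build _ _ _ _ _ h2L).
  rewrite (coord_vbasis (memvf u)) -[h1]/(H1 : _ -> _) -[h2]/(H2 : _ -> _).
  rewrite !linear_sum; apply: eq_bigr => i _; rewrite !linearZ.
  by rewrite /= h12.
have dvL (x : 'rV[R]_m) : linear (fun u : subvs_of U => dot (vsval u) x : R^o).
  by move=> a y z; rewrite linearP dotC dot_linear (dotC x) (dotC x).
have phi_inj : lker phi == 0%VS.
  apply/lker0P => x y; rewrite !phiE => xy.
  suff : dot (vsval (x - y)) (vsval (x - y)) = 0.
    move/eqP; rewrite dot_eq0 => /eqP xy0.
    by apply/eqP; rewrite -subr_eq0; apply/eqP/val_inj.
  apply: (extd (fun u => dot (vsval u) (vsval (x - y))) (fun=> 0)) => //.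
    by move=> a ? ?; rewrite scaler0 addr0.
  move=> i; have /rowP/(_ i) := xy; rewrite !mxE => xyi.
  rewrite linearB /= -scaleN1r addrC dot_linear xyi.
  by rewrite [_ *: _]mulN1r addNr.
have phi_sur z : phi (phi^-1%VF z) = z.
  apply: limg_lfunVK.
  suff -> : limg phi = fullv by exact: memvf.
  apply/eqP; rewrite eqEdim subvf limg_dim_eq; last first.
    by move/eqP: phi_inj => ->; rewrite capv0.
  by rewrite [\dim {: 'rV_d}]dimvf /dim /= mul1n.
exists (phi^-1 \o psi)%VF => {}v {}w.
apply: (extd (fun v => dot (f v) w) (fun v => dot (vsval v) (vsval _))) => //.
  by move=> a y z; rewrite linearP dotC dot_linear (dotC w) (dotC w).
move=> i; have /rowP/(_ i) := phi_sur (psi w).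
by rewrite comp_lfunE phiE mxE => ->; rewrite psiE mxE.
Qed.

End Euclidean.

Section Centered.
Variable R : realType.

Definition centered n (rho : 'rV[R]_n) : 'rV[R]_n :=
  rho - ((\sum_(i < n) rho 0 i) / n%:R) *: const_mx 1.

Definition calV n : {vspace 'rV[R]_(n + n)} :=
  dsumv (perp (const_mx 1 : 'rV[R]_n)) (perp (const_mx 1 : 'rV[R]_n)).

End Centered.

(* Main.v *)
(* Write x = (alpha, beta), y = (u, v) in the centered space V, kappa = Omega(y)
   and w = J y. The variance is additive under convolution, so |kappa| = |y|, and
   everything rests on the majorization |w|^2 <= max_p <w, kappa o p>.

   To obtain it, let gamma(s) = Omega(x + s y). For weights c, the product over all
   permutations p of <c, gamma(s) o p> is a polynomial in s of degree at most n!, by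
   the symmetric function theorem. If every asymptotic slope <c, kappa o p> is
   negative, then each factor runs from + to -, hence has exactly one zero, and a
   factor cannot increase through its zero. So <c, w> <= max_p <c, kappa o p>. The
   curves gamma are globally smooth when the line x + s y avoids the pairs whose
   entries collide on both sides, which holds for generic y; limits do the rest.
   Real-rootedness of the output is Walsh's theorem, proved through Laguerre's
   theorem on polar derivatives in a half plane.

   If |J y| = |y| and Omega(y) is simple, the equality case makes w a permutation of
   kappa, so w has distinct entries. The centered point x0 is isometric. If another y
   were, subtracting the right multiple of x0 would make w weakly increasing with a
   tie; but the transpose of J maps such a nonconstant w to a strictly increasing u,
   so Omega(y) would be simple, contradicting the tie. The last monotonicity follows
   from the positivity of the residues of quotients of interlacing polynomials. *)

Require Import Defs.
From mathcomp Require Import all_boot all_order all_algebra all_fingroup.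
From mathcomp Require Import zify.
From mathcomp Require mpoly.
Set Implicit Arguments.
Unset Strict Implicit.
Unset Printing Implicit Defensive.
Import Order.TTheory GRing.Theory Num.Theory.
Local Open Scope ring_scope.

(** * Products of a linear form over all permutations of its variables *)

Module SymmetricOrbit.
Import mpoly.
Section SymmetricOrbit.
Variables (R : idomainType) (n : nat) (c : 'I_n -> R).

Definition orbit_poly : {mpoly R[n]} :=
  \prod_(s : 'S_n) \sum_(k < n) c k *: 'X_(s k).

Lemma orbit_poly_sym : orbit_poly \is symmetric.
Proof.
apply/issymP => t; rewrite /orbit_poly rmorph_prod /=.
rewrite [RHS](reindex_inj (mulIg t)) /=; apply: eq_bigr => s _.
rewrite raddf_sum; apply: eq_bigr => k _.
rewrite /= msymZ permM; congr (_ *: _).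
rewrite msymX; congr mpolyX; apply/mnmP => i.
by rewrite mnmE !mnm1E -(inj_eq (@perm_inj _ t)) permKV.
Qed.

Lemma orbit_poly_homog : orbit_poly \is (n`!).-homog.
Proof.
rewrite -card_Sn /orbit_poly -[#|_|]/(#|{:'S_n}|) cardT enumT /index_enum.
elim: (Finite.enum _) => [|s l IH]; first by rewrite big_nil dhomog1.
rewrite big_cons -[size _]/(1 + size l)%N; apply: dhomogM => //.
apply: rpred_sum => k _; apply: rpredZ.
by rewrite dhomogX /= mdeg1.
Qed.

Lemma orbit_poly_eval (v : 'I_n -> R) :
  orbit_poly.@[v] = \prod_(s : 'S_n) \sum_(k < n) c k * v (s k).
Proof.
rewrite /orbit_poly rmorph_prod /=; apply: eq_bigr => s _.
by rewrite raddf_sum; apply: eq_bigr => k _; rewrite /= mevalZ mevalXU.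
Qed.

Definition size_le (p : {poly R}) d := (size p <= d.+1)%N.

Lemma size_leM p q d e : size_le p d -> size_le q e -> size_le (p * q) (d + e).
Proof.
by rewrite /size_le => hp hq; apply: leq_trans (size_polyMleq _ _) _; lia.
Qed.

(** By the fundamental theorem on symmetric functions, the orbit product is a polynomial [t] in the
    elementary symmetric functions, of weighted degree [n!]. Along [g s] the $j$-th of them is, up
    to sign, [E j], of degree at most $j$ in [s], so weight bounds degree. *)
Lemma orbit_prod_poly (g : R -> 'I_n -> R) (E : nat -> {poly R}) :
  (forall s j, (j <= n)%N -> (\prod_i ('X - (g s i)%:P))`_(n - j) = (E j).[s]) ->
  (forall j, size (E j) <= j.+1)%N ->
  exists2 D : {poly R}, (size D <= (n`!).+1)%N &
    forall s, D.[s] = \prod_(p : 'S_n) \sum_(k < n) c k * g s (p k).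
Proof.
move=> gE sE; have [t [tE tH]] := sym_fundamental_homog orbit_poly_sym orbit_poly_homog.
(* The variables of [t] are numbered from 0: variable [i] stands for the elementary symmetric
   function of degree [i.+1], and the sign is that of Vieta's formulas. *)
pose e (i : 'I_n) := (-1) ^+ i.+1 *: E i.+1.
exists (\sum_(m <- msupp t) t@_m *: \prod_(i < n) e i ^+ m i).
  rewrite big_seq; apply: (leq_trans (size_sum _ _ _)); apply/bigmax_leqP_seq => m mt _.
  apply: (leq_trans (size_scale_leq _ _)); have /dhomogP/(_ m mt) <- := tH.
  apply: (big_ind2 size_le) => [|p1 d1 p2 d2|i _].
  - by rewrite /size_le size_poly1.
  - exact: size_leM.
  elim: (m i) => [|k IH]; first by rewrite expr0 mul0n /size_le size_poly1.
  rewrite exprS mulSn; apply: size_leM IH.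
  by rewrite /size_le (leq_trans (size_scale_leq _ _)).
move=> s; rewrite -orbit_poly_eval -tE comp_mpoly_meval mevalE horner_sum.
apply: eq_bigr => m _; rewrite hornerZ horner_prod; congr (_ * _).
apply: eq_bigr => i _; rewrite horner_exp hornerZ -gE //; congr (_ ^+ _).
rewrite tnth_mktuple.
have -> : \prod_i ('X - (g s i)%:P) = \prod_(x <- [tuple g s k | k < n]) ('X - x%:P).
  by rewrite big_tuple; under [RHS]eq_bigr do rewrite tnth_mktuple.
have := mroots_coeff [tuple g s k | k < n] (inord i.+1).
rewrite inordK ?ltnS // => ->.
rewrite mulrA -exprD addnn -signr_odd odd_double mul1r.
by apply: meval_eq => k; rewrite tnth_mktuple.
Qed.
End SymmetricOrbit.
End SymmetricOrbit.

From mathcomp Require Import all_classical all_reals all_analysis.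
From mathcomp Require Import complex polyrcf ring lra.
Import numFieldNormedType.Exports.
Local Open Scope classical_set_scope.
Local Open Scope ring_scope.

(** * Finite free convolution as a differential operator *)

(** The classical formula $n!\,(p\boxplus_nq)=\sum_jq^{(n-j)}(0)\,p^{(j)}$. It also makes sense over
    the complex numbers and for [p] of degree below [n], and both extensions are used. *)
Definition fconv {F : fieldType} n (p q : {poly F}) : {poly F} :=
  \sum_(j < n.+1) ((n - j)`!%:R / n`!%:R * q`_(n - j)) *: p^`(j).

Section Conv.
Variable R : realType.
Implicit Types p q : {poly R}.

Lemma fact_neq0 (F : numFieldType) m : m`!%:R != 0 :> F.
Proof. by rewrite pnatr_eq0 -lt0n fact_gt0. Qed.

(** In degree [m] only [k = n - m] contributes on the left; the substitution [i = n - m - j] then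
    matches the two sums, as $a_i$ is up to sign the coefficient of [p] in degree [j + m]. *)
Lemma boxplusE n p q : (size p <= n.+1)%N -> boxplus n p q = fconv n p q.
Proof.
move=> sp; apply/polyP => m.
have pz k : (n < k)%N -> p`_k = 0 by move=> nk; rewrite nth_default // (leq_trans sp).
rewrite /fconv /boxplus !coef_sum.
under [RHS]eq_bigr => j _ do rewrite coefZ coef_derivn.
under [LHS]eq_bigr => k _ do rewrite coefZ coefXn.
have [nm|mn] := ltnP n m.
  rewrite !big1// => i _; first by rewrite pz ?mul0rn ?mulr0 // ltn_addl.
  by rewrite gtn_eqF ?mulr0// (leq_ltn_trans (leq_subr _ _)).
have mi : (n - m < n.+1)%N by rewrite ltnS leq_subr.
rewrite (bigD1 (Ordinal mi)) //= subKn // eqxx mulr1 big1 ?addr0; last first.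
  move=> i /negPf ni; case: eqP => [mE|]; rewrite ?mulr0 //.
  move/negP: ni; case; apply/eqP/val_inj => /=; rewrite mE subKn //.
  by rewrite -ltnS.
pose G j := (n - j)`!%:R / n`!%:R * q`_(n - j) * (p`_(j + m) *+ (j + m) ^_ j).
rewrite [RHS](bigID (fun j : 'I_n.+1 => (j < (n - m).+1)%N)) /= [X in _ + X]big1 ?addr0; last first.
  move=> j; rewrite ltnS -ltnNge => jnm.
  by rewrite addnC pz ?mul0rn ?mulr0 // -ltn_subLR.
transitivity (\sum_(i < (n - m).+1) G i); last by rewrite (big_ord_widen n.+1 G).
rewrite /boxplus_coef (subKn mn) mulr_sumr (reindex_inj rev_ord_inj) /=.
apply: eq_bigr => -[j /= + _]; rewrite ltnS subSS /G => jnm.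
rewrite /acoef (subKn jnm) (_ : n - (n - m - j) = j + m)%N; last by lia.
have -> : (-1) ^+ (n - m) = (-1) ^+ (n - m - j) * (-1) ^+ j :> R.
  by rewrite -exprD subnK.
have sgn k : (-1) ^+ k * (-1) ^+ k = 1 :> R by rewrite -signr_odd -expr2 sqrr_sign.
rewrite -[p`_(j + m) *+ _]mulr_natr.
have -> : ((j + m) ^_ j)%:R = (j + m)`!%:R / m`!%:R :> R.
  apply: (canRL (mulfK (fact_neq0 _ _))).
  by rewrite -natrM -{2}(addKn j m) ffact_fact // leq_addr.
rewrite !natrM.
set a := (-1) ^+ (n - m - j); set b := (-1) ^+ j.
rewrite invfM.
transitivity ((a * a) * (b * b) * ((n - j)`!%:R / n`!%:R * q`_(n - j) *
  (p`_(j + m) * ((j + m)`!%:R / m`!%:R)))).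
  ring.
by rewrite !sgn !mul1r.
Qed.
End Conv.

Section FconvTheory.
Variables (F : numFieldType) (n : nat).
Implicit Types p q : {poly F}.

Lemma fconvDl p1 p2 q : fconv n (p1 + p2) q = fconv n p1 q + fconv n p2 q.
Proof. by rewrite /fconv -big_split; apply: eq_bigr => j _; rewrite derivnD scalerDr. Qed.

Lemma fconvZl c p q : fconv n (c *: p) q = c *: fconv n p q.
Proof.
rewrite /fconv scaler_sumr; apply: eq_bigr => j _.
by rewrite derivnZ !scalerA mulrC.
Qed.

Lemma fconvDr p q1 q2 : fconv n p (q1 + q2) = fconv n p q1 + fconv n p q2.
Proof.
rewrite /fconv -big_split; apply: eq_bigr => j _.
by rewrite coefD mulrDr scalerDl.
Qed.

Lemma fconvZr c p q : fconv n p (c *: q) = c *: fconv n p q.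
Proof.
rewrite /fconv scaler_sumr; apply: eq_bigr => j _.
by rewrite coefZ !scalerA mulrCA.
Qed.
End FconvTheory.

Section Translate.
Variable F : numFieldType.
Lemma derivn_translate (p : {poly F}) c j :
  (p \Po ('X - c%:P))^`(j) = p^`(j) \Po ('X - c%:P).
Proof.
elim: j => [|j IH]; first by rewrite !derivn0.
by rewrite !derivnS IH deriv_comp derivXsubC mulr1.
Qed.

Lemma fconv_translate n (p q : {poly F}) c :
  fconv n (p \Po ('X - c%:P)) q = fconv n p q \Po ('X - c%:P).
Proof.
rewrite /fconv rmorph_sum /=; apply: eq_bigr => j _.
by rewrite derivn_translate comp_polyZ.
Qed.

(** The polynomial differentiated here is the polar derivative of [p] with pole [w]; each
    differentiation lowers its formal degree [m] by one. *)
Lemma derivn_polar (p : {poly F}) m w j z :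
  (m%:R *: p - ('X - w%:P) * p^`())^`(j).[z] =
  (m%:R - j%:R) * p^`(j).[z] - (z - w) * p^`(j.+1).[z].
Proof.
have -> : (m%:R *: p - ('X - w%:P) * p^`())^`(j) =
    (m%:R - j%:R) *: p^`(j) - ('X - w%:P) * p^`(j.+1).
  elim: j => [|j IH]; first by rewrite !derivn0 subr0 derivnS derivn0.
  rewrite derivnS {}IH derivB derivZ derivM derivXsubC mul1r -!derivnS.
  rewrite opprD addrA; congr (_ - _).
  by rewrite -[X in _ - X]scale1r -scalerBl -[j.+1]addn1 natrD; congr (_ *: _); ring.
by rewrite !hornerE.
Qed.

(* Walsh's convolution reduces to degree m by a polar derivative of the first
   argument, with pole [z - x], when a linear factor is split off the second. *)
Lemma fconv_polar m (P Q : {poly F}) x z : (size Q <= m.+1)%N ->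
  (fconv m.+1 P (('X - x%:P) * Q)).[z] =
  m.+1%:R^-1 * (fconv m (m.+1%:R *: P - ('X - (z - x)%:P) * P^`()) Q).[z].
Proof.
move=> sQ; rewrite /fconv !horner_sum.
under eq_bigr do rewrite hornerZ.
under [in RHS]eq_bigr do rewrite hornerZ derivn_polar subKr mulrBr.
have m0 : m.+1%:R != 0 :> F by rewrite pnatr_eq0.
have coefE k : (('X - x%:P) * Q)`_k.+1 = Q`_k - x * Q`_k.+1.
  by rewrite mulrBl coefB coefXM mul_polyC coefZ.
have coefE0 : (('X - x%:P) * Q)`_0 = - x * Q`_0.
  by rewrite mulrBl coefB coefXM mul_polyC coefZ sub0r mulNr.
rewrite mulr_sumr.
transitivity (\sum_(j < m.+1) ((m.+1 - j)`!%:R / m.+1`!%:R * Q`_(m - j)) * P^`(j).[z] -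
   \sum_(j < m.+1) x * ((m - j)`!%:R / m.+1`!%:R * Q`_(m - j)) * P^`(j.+1).[z]); last first.
  rewrite -sumrB; apply: eq_bigr => -[j /=]; rewrite ltnS => jm _.
  rewrite subSn // !factS !natrM.
  have -> : m.+1%:R - j%:R = (m - j).+1%:R :> F by rewrite -natrB ?subSn // leqW.
  by field; rewrite fact_neq0 nat1r m0.
transitivity (\sum_(j < m.+2) ((m.+1 - j)`!%:R / m.+1`!%:R *
     (if (j < m.+1)%N then Q`_(m - j) else 0)) * P^`(j).[z] -
   \sum_(j < m.+2) x * ((m.+1 - j)`!%:R / m.+1`!%:R *
     (if j == 0 :> nat then 0 else Q`_(m.+1 - j))) * P^`(j).[z]).
  rewrite -sumrB; apply: eq_bigr => -[j /=]; rewrite ltnS => jm _.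
  case: j jm => [|j] jm /=.
    by rewrite !subn0 coefE [Q`_m.+1]nth_default // !mulr0 subr0 mul0r subr0.
  have [jm'|mj] := ltnP j.+1 m.+1.
    rewrite subSS; have -> : (m - j = (m - j.+1).+1)%N by lia.
    by rewrite coefE; ring.
  have -> : (m.+1 - j.+1 = 0)%N by lia.
  by rewrite coefE0; ring.
congr (_ - _).
  rewrite big_ord_recr /= ltnn !mulr0 mul0r addr0.
  by apply: eq_bigr => j _; rewrite ltn_ord.
rewrite big_ord_recl /= !mulr0 mul0r add0r.
by apply: eq_bigr => j _.
Qed.
End Translate.

(** * Laguerre's theorem in a half plane, and Walsh's theorem *)

Section Grace.
Variable R : realType.
Local Notation C := (R[i]%C).
Local Notation Re := complex.Re.
Local Notation Im := complex.Im.

Lemma ImD (x y : C) : Im (x + y) = Im x + Im y. Proof. by case: x y => [a b] [c d]. Qed.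
Lemma ReD (x y : C) : Re (x + y) = Re x + Re y. Proof. by case: x y => [a b] [c d]. Qed.

(* Inversion maps the half plane [d < Im u] into a disc; this is the open half
   plane cut out by the tangent of that disc at the inverse of [e + i d]. *)
Lemma half_plane_inv (d e : R) (u : C) : 0 <= d -> 0 < e ^+ 2 + d ^+ 2 -> d < Im u ->
  2 * d * e * Re u^-1 + (e ^+ 2 - d ^+ 2) * Im u^-1 < d.
Proof.
case: u => p q /= d0 ed dq.
have q0 : 0 < q by apply: le_lt_trans dq.
have N0 : 0 < p ^+ 2 + q ^+ 2 by rewrite ltr_wpDl ?sqr_ge0 // exprn_gt0.
rewrite -subr_gt0.
have -> : d - (2 * d * e * (p / (p ^+ 2 + q ^+ 2)) + (e ^+ 2 - d ^+ 2) * - (q / (p ^+ 2 + q ^+ 2)))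
  = (d * (p - e) ^+ 2 + (e ^+ 2 * (q - d) + d * q * (q - d))) / (p ^+ 2 + q ^+ 2).
  by field; rewrite gt_eqF.
have qd : 0 < q - d by rewrite subr_gt0.
rewrite divr_gt0 // ltr_wpDl ?(mulr_ge0 d0 (sqr_ge0 _)) //.
move: d0; rewrite le_eqVlt => /orP[/eqP d0|d0].
  by move: ed; rewrite -d0 !mul0r addr0 expr0n /= addr0 subr0 => ed; rewrite mulr_gt0.
by rewrite ltr_wpDl // ?mulr_gt0 // mulr_ge0 ?sqr_ge0 // ltW.
Qed.

(** Laguerre's theorem. Equality would make the sum of the $(y-a)^{-1}$ equal to $(m+1)(y-w)^{-1}$.
    But the linear functional [L] is less than [d] at each $(y-a)^{-1}$ by [half_plane_inv], equals
    [d] at $(y-w)^{-1}$, and there are at most $m+1$ roots. *)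
Lemma polar_half_plane (h : R) m (rs : seq C) (y w : C) :
  (size rs <= m.+1)%N -> all (fun a => Im a < h) rs -> h <= Im y -> Im w = h ->
  m.+1%:R != (y - w) * \sum_(a <- rs) (y - a)^-1.
Proof.
move=> srs rsh hy wh; apply/eqP => E.
have m0 : m.+1%:R != 0 :> C by rewrite pnatr_eq0.
have yw : y - w != 0.
  by apply: contra_neq m0 => yw; rewrite E yw mul0r.
have VE : \sum_(a <- rs) (y - a)^-1 = m.+1%:R * (y - w)^-1.
  by rewrite E mulrC mulrA mulVf // mul1r.
have rs0 : rs != [::] by apply: contra_eq_neq E => ->; rewrite big_nil mulr0.
set d := Im y - h; set e := Re y - Re w.
have d0 : 0 <= d by rewrite subr_ge0.
have ywE : y - w = Complex e d.
  by move: wh; rewrite /e /d; case: (y) (w) => [a b] [c f] /= ->.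
have ed : 0 < e ^+ 2 + d ^+ 2.
  rewrite lt_neqAle addr_ge0 ?sqr_ge0 // andbT eq_sym paddr_eq0 ?sqr_ge0 //.
  by rewrite !sqrf_eq0; move: yw; rewrite ywE eq_complex.
pose L (v : C) := 2 * d * e * Re v + (e ^+ 2 - d ^+ 2) * Im v.
have LD : {morph L : u v / u + v} by move=> u v; rewrite /L ReD ImD; ring.
have L0 : L 0 = 0 by rewrite /L /= !mulr0 addr0.
have Lv0 k : L (k%:R * (y - w)^-1) = k%:R * d.
  rewrite mulr_natl; elim: k => [|k IH]; first by rewrite mulr0n L0 mul0r.
  rewrite mulrS LD IH -[k.+1]add1n natrD mulrDl; congr (_ + _).
  by rewrite ywE /L /=; field; rewrite gt_eqF.
have : L (\sum_(a <- rs) (y - a)^-1) < (size rs)%:R * d.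
  have -> : (size rs)%:R * d = \sum_(a <- rs) d.
    by rewrite big_const_seq count_predT iter_addr_0 mulr_natl.
  rewrite (big_morph L LD L0).
  elim: rs rs0 rsh {srs E VE} => // a rs IH _ /= /andP[ah rsh].
  have ai : L (y - a)^-1 < d.
    apply: half_plane_inv => //.
    by rewrite /d; case: (y) (a) ah {IH} => [? ?] [? ?] /= *; lra.
  have [->|rs0] := eqVneq rs [::]; first by rewrite !big_seq1.
  by rewrite !big_cons ltrD // IH.
rewrite VE Lv0 ltNge ler_wpM2r // ler_nat; exact: srs.
Qed.

End Grace.

Lemma deriv_prod_XsubC (F : fieldType) (rs : seq F) y : all (fun a => y != a) rs ->
  (\prod_(a <- rs) ('X - a%:P))^`().[y] =
  (\prod_(a <- rs) ('X - a%:P)).[y] * \sum_(a <- rs) (y - a)^-1.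
Proof.
elim: rs => [_|a rs IH /= /andP[ya /IH E]].
  by rewrite !big_nil mulr0 derivC hornerC.
rewrite !big_cons derivM derivXsubC mul1r !hornerE E.
by field; rewrite subr_eq0.
Qed.

Definition realrooted (R : realType) (p : {poly R}) :=
  exists l : seq R, p = lead_coef p *: \prod_(x <- l) ('X - x%:P).

Section Grace.
Variable R : realType.
Local Notation C := (R[i]%C).
Local Notation Re := complex.Re.
Local Notation Im := complex.Im.
Local Notation toC := (real_complex R).

(** By [fconv_polar], splitting off one root [x] of the second argument replaces [P] by its polar
    derivative with pole [z - x]. The pole stays on the boundary line since [x] is real, so by
    Laguerre the new polynomial again has no zero in the closed half plane. *)
Lemma fconv_half_plane (h : R) n (P : {poly C}) (b : seq R) z :
  size b = n -> (size P <= n.+1)%N -> (forall y, h <= Im y -> P.[y] != 0) -> Im z = h ->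
  (fconv n P (\prod_(x <- b) ('X - (toC x)%:P))).[z] != 0.
Proof.
elim: n b P => [|m IH] [|x b] P //= => [_ sP Ph zh|[sb] sP Ph zh].
  rewrite /fconv big_ord1 derivn0 big_nil coef1 /= fact0 divr1 mulr1 scale1r.
  by apply: Ph; rewrite zh.
have wh : Im (z - toC x) = h by rewrite -zh; case: (z) => ? ? /=; lra.
have m0 : m.+1%:R != 0 :> C by rewrite pnatr_eq0.
rewrite big_cons fconv_polar; last by rewrite size_prod_XsubC sb.
rewrite mulf_eq0 invr_eq0 (negPf m0) /=; apply: IH => //.
  (* The terms of degree [m.+1] cancel in the polar derivative, so the induction hypothesis applies
     in degree [m]. *)
  apply/leq_sizeP => j mj; rewrite mulrBl coefB coefZ coefB coefXM mul_polyC coefZ.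
  case: j mj => // j mj; rewrite !coef_deriv [P`_j.+2]nth_default ?(leq_trans sP) //.
  rewrite mul0rn mulr0 subr0; move: mj; rewrite leq_eqVlt => /orP[/eqP[<-]|mj].
    by rewrite mulr_natl subrr.
  by rewrite nth_default ?mulr0 ?mul0rn ?subrr // (leq_trans sP).
move=> y hy; have [rs PE] := closed_field_poly_normal P.
have P0 : lead_coef P != 0.
  rewrite lead_coef_eq0; apply: contra_neq (Ph y hy) => ->; exact: horner0.
have srs : (size rs <= m.+1)%N.
  by move: sP; rewrite PE size_scale // size_prod_XsubC ltnS.
have rsh : all (fun a => Im a < h) rs.
  apply/allP => a ars; rewrite ltNge; apply/negP => /Ph; rewrite PE hornerZ.
  by rewrite mulf_eq0 negb_or => /andP[_]; rewrite -[_ == 0]/(root _ a) root_prod_XsubC ars.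
have yrs : all (fun a => y != a) rs.
  by apply/allP => a /(allP rsh) ah; apply: contraTneq hy => ->; rewrite -ltNge.
have := polar_half_plane srs rsh hy wh; apply: contra => /eqP E; apply/eqP.
have Py : P.[y] != 0 by apply: Ph.
have D : P^`().[y] = P.[y] * \sum_(a <- rs) (y - a)^-1.
  by rewrite PE derivZ !hornerZ deriv_prod_XsubC // mulrA.
move: E; rewrite hornerD hornerN hornerZ hornerM hornerXsubC D => /eqP.
by rewrite subr_eq0 mulrCA [_ * P.[y]]mulrC => /eqP /(mulfI Py).
Qed.

Lemma map_prod_XsubC (b : seq R) : map_poly toC (\prod_(x <- b) ('X - x%:P)) =
  \prod_(x <- b) ('X - (toC x)%:P).
Proof.
elim: b => [|x b IH]; first by rewrite !big_nil rmorph1.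
by rewrite !big_cons rmorphM /= IH rmorphB /= map_polyX map_polyC.
Qed.

(** Conjugation permutes the roots of a real polynomial, so none lies below the real axis either. *)
Lemma realrooted_of_half_plane (p : {poly R}) :
  (forall z : C, 0 < Im z -> (map_poly toC p).[z] != 0) -> realrooted p.
Proof.
move=> ph; have p0 : p != 0.
  by apply: contra_neq (ph 'i%C ltr01) => ->; rewrite rmorph0 horner0.
have [rs pE] := closed_field_poly_normal (map_poly toC p).
have rsr : {in rs, forall z, z = toC (Re z)}.
  move=> z zrs; have rz : root (map_poly toC p) z.
    by rewrite pE rootZ ?root_prod_XsubC // lead_coef_eq0 map_poly_eq0.
  apply/eqP; rewrite eq_complex /= eqxx /=; apply: contraTT isT => zi.
  case: (ltrgt0P (Im z)) zi => // zi _; first by move/negP: (ph z zi); case.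
  have := ph (z^*)%C; rewrite (_ : Im _ = - Im z); last by case: (z).
  rewrite oppr_gt0 => /(_ zi) /negP[].
  rewrite -[_ == 0]/(root _ _) -(complex_root_conj (map_poly toC p)) in rz *.
  rewrite -map_poly_comp (eq_map_poly (g := toC)) //.
  by move=> x /=; exact: conjc_real.
exists [seq Re z | z <- rs]; apply: (map_poly_inj toC).
rewrite pE map_polyZ lead_coef_map; congr (_ *: _).
rewrite map_prod_XsubC big_map big_seq [RHS]big_seq.
by apply: eq_bigr => z /rsr {1}->.
Qed.

(** Walsh's theorem. A zero [z] above the real axis is excluded by [fconv_half_plane] with the
    boundary line drawn through [z] itself: all roots of [p] are real, hence below it. *)
Lemma realrooted_fconv n (p : {poly R}) (b : seq R) : size b = n -> (size p <= n.+1)%N ->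
  p != 0 -> realrooted p -> realrooted (fconv n p (\prod_(x <- b) ('X - x%:P))).
Proof.
move=> sb sp p0 [l pE]; apply: realrooted_of_half_plane => z zi.
have -> : map_poly toC (fconv n p (\prod_(x <- b) ('X - x%:P))) =
    fconv n (map_poly toC p) (\prod_(x <- b) ('X - (toC x)%:P)).
  rewrite /fconv rmorph_sum /=; apply: eq_bigr => j _.
  rewrite map_polyZ derivn_map !rmorphM fmorphV !rmorph_nat -coef_map.
  by rewrite map_prod_XsubC.
apply: (fconv_half_plane (h := Im z)) => //; first by rewrite size_map_poly.
move=> y zy; rewrite pE map_polyZ hornerZ mulf_neq0 //=.
  by rewrite fmorph_eq0 lead_coef_eq0.
rewrite map_prod_XsubC horner_prod prodf_seq_neq0; apply/allP => x _ /=.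
rewrite !hornerE subr_eq0.
by apply: contraTneq zi => yx; rewrite -leNgt (le_trans zy) // yx.
Qed.
End Grace.

(** * Real-rooted polynomials and their perturbations *)

Section Rpoly.
Variable R : realType.

Definition entries n (a : 'rV[R]_n) : seq R := [seq a 0 i | i <- enum 'I_n].

Lemma size_entries n (a : 'rV[R]_n) : size (entries a) = n.
Proof. by rewrite size_map size_enum_ord. Qed.

Lemma rpolyE n (a : 'rV[R]_n) : rpoly a = \prod_(x <- entries a) ('X - x%:P).
Proof. by rewrite big_map big_enum. Qed.

Lemma size_rpoly n (a : 'rV[R]_n) : size (rpoly a) = n.+1.
Proof. by rewrite rpolyE size_prod_XsubC size_entries. Qed.

Lemma monic_rpoly n (a : 'rV[R]_n) : rpoly a \is monic.
Proof. exact: monic_prod_XsubC. Qed.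

Lemma horner_rpoly n (a : 'rV[R]_n) t : (rpoly a).[t] = \prod_i (t - a 0 i).
Proof. by rewrite horner_prod; apply: eq_bigr => i _; rewrite hornerXsubC. Qed.

Lemma realrooted_rpoly n (a : 'rV[R]_n) : realrooted (rpoly a).
Proof.
by exists (entries a); rewrite (monicP (monic_rpoly a)) scale1r rpolyE.
Qed.

Lemma exists_gap n (b : 'rV[R]_n) : injective (b 0) ->
  exists2 e : R, 0 < e & forall i j, i != j -> e *+ 2 < `|b 0 i - b 0 j|.
Proof.
move=> bI; have : \forall e \near 0^'+, forall ij : 'I_n * 'I_n,
    ij.1 != ij.2 -> e *+ 2 < `|b 0 ij.1 - b 0 ij.2|.
  apply: filter_forall => -[i j] /=; have [->|ij] := eqVneq i j.
    exact: nearW.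
  have gt0 : 0 < `|b 0 i - b 0 j| / 2.
    rewrite divr_gt0 // normr_gt0 subr_eq0; apply: contra_neq ij; exact: bI.
  by apply: filterS (nbhs_right_lt gt0) => e; rewrite ltr_pdivlMr // mulr_natr.
have pos : \forall e \near (0:R)^'+, 0 < e by exact: nbhs_right_gt.
move=> near_gap; have [e []] := filter_ex (filterI pos near_gap).
by move=> e0 gap; exists e => // i j ij; apply: (gap (i, j)).
Qed.

(** Each of the [n] disjoint intervals of radius [e] carries a sign change, hence a root of [q]; the
    degree leaves room for no others. *)
Lemma rpoly_near n (b : 'rV[R]_n) e (q : {poly R}) : 0 < e ->
  (forall i j, i != j -> e *+ 2 < `|b 0 i - b 0 j|) ->
  q \is monic -> size q = n.+1 ->
  (forall k, q.[b 0 k - e] * q.[b 0 k + e] < 0) ->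
  exists2 b' : 'rV[R]_n, q = rpoly b' & forall k, `|b' 0 k - b 0 k| < e.
Proof.
move=> e0 gap qm sq sgn.
have /choice [f fP] : forall k : 'I_n, exists x, root q x /\ `|x - b 0 k| < e.
  move=> k; have [||x xI rx] := @poly_ivtoo R q (b 0 k - e) (b 0 k + e).
  - by rewrite lerD2l; lra.
  - exact: sgn.
  exists x; split=> //; move: xI; rewrite in_itv /= => /andP[? ?].
  by rewrite ltr_norml; apply/andP; split; lra.
pose b' : 'rV[R]_n := \row_k f k.
exists b'; last by move=> k; rewrite mxE; case: (fP k).
have -> : q = lead_coef q *: \prod_(x <- entries b') ('X - x%:P).
  apply: all_roots_prod_XsubC; first by rewrite sq size_entries.
    by apply/allP => x /mapP[k _ ->]; rewrite mxE; case: (fP k).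
  rewrite uniq_rootsE map_inj_uniq ?enum_uniq // => i j; rewrite !mxE => fij.
  apply/eqP; apply: contraT => /gap; rewrite ltNge => /negP[].
  rewrite (_ : b 0 i - b 0 j = (f j - b 0 j) - (f i - b 0 i)); last by rewrite fij; ring.
  by rewrite (le_trans (ler_normB _ _)) // mulr2n lerD // ltW //; case: (fP i); case: (fP j).
by rewrite (monicP qm) scale1r rpolyE.
Qed.

Lemma rpoly_sign n (b : 'rV[R]_n) e : 0 < e ->
  (forall i j, i != j -> e *+ 2 < `|b 0 i - b 0 j|) ->
  forall k, (rpoly b).[b 0 k - e] * (rpoly b).[b 0 k + e] < 0.
Proof.
move=> e0 gap k; rewrite !horner_rpoly -big_split /= (bigD1 k) //=.
rewrite nmulr_rlt0; last by rewrite nmulr_rlt0; lra.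
apply: prodr_gt0 => i ik; have := gap _ _ ik; rewrite ltr_normr => /orP[] h.
  by rewrite nmulr_rgt0; lra.
by rewrite pmulr_rgt0; lra.
Qed.

(** The signs at the ends of the isolating intervals persist for small [t], and [h] is of too low a
    degree to disturb the leading term. *)
Lemma rpoly_perturb n (b : 'rV[R]_n) (h : {poly R}) : injective (b 0) ->
  (size h <= n)%N ->
  \forall t \near (0 : R), exists b' : 'rV[R]_n, rpoly b + t *: h = rpoly b'.
Proof.
move=> bI sh; have [e e0 gap] := exists_gap bI.
have H : \forall t \near (0 : R), forall k,
    (rpoly b + t *: h).[b 0 k - e] * (rpoly b + t *: h).[b 0 k + e] < 0.
  apply: (@filter_forall _ _ _ _ (nbhs_filter (0 : R))) => k.
  pose g t := (rpoly b + t *: h).[b 0 k - e] * (rpoly b + t *: h).[b 0 k + e].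
  have gE : g = horner (((rpoly b).[b 0 k - e]%:P + h.[b 0 k - e] *: 'X) *
      ((rpoly b).[b 0 k + e]%:P + h.[b 0 k + e] *: 'X)).
    by apply/funext => t; rewrite /g !hornerE ![t * _]mulrC.
  have : g t @[t --> 0] --> g 0 by rewrite gE; exact: continuous_horner.
  move/cvgr_lt; apply; rewrite /g scale0r addr0; exact: rpoly_sign.
apply: filterS H => t Ht; have [] := @rpoly_near n b e (rpoly b + t *: h) => //.
- rewrite monicE lead_coefDl ?(monicP (monic_rpoly b)) //.
  by rewrite size_rpoly ltnS (leq_trans (size_scale_leq _ _)).
- by rewrite size_polyDl size_rpoly // ltnS (leq_trans (size_scale_leq _ _)).
by move=> b' ? _; exists b'.
Qed.

Lemma deriv_XsubCM x (f : {poly R}) :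
  (('X - x%:P) * f)^`() = f + ('X - x%:P) * f^`().
Proof. by rewrite derivM derivXsubC mul1r. Qed.

(** Away from the roots the expression is $f^2\sum_x(y-x)^{-2}$; the induction on [l] avoids
    dividing at a root. *)
Lemma laguerre_ge0 (l : seq R) y (f := \prod_(x <- l) ('X - x%:P)) :
  0 <= f^`().[y] ^+ 2 - f.[y] * f^`()^`().[y].
Proof.
rewrite {}/f; elim: l => [|x l IH].
  by rewrite big_nil derivC derivC !hornerC mulr0 expr0n subr0.
rewrite big_cons; set f := \prod_(_ <- _) _ in IH *.
rewrite deriv_XsubCM derivD deriv_XsubCM !hornerE.
rewrite [X in 0 <= X](_ : _ = f.[y] ^+ 2 + (y - x) ^+ 2 * (f^`().[y] ^+ 2 - f.[y] * f^`()^`().[y])).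
  by rewrite addr_ge0 ?sqr_ge0 // mulr_ge0 ?sqr_ge0.
by rewrite /=; ring.
Qed.

Lemma laguerre_gt0 (p : {poly R}) y : realrooted p -> (1 < size p)%N -> p.[y] != 0 ->
  0 < p^`().[y] ^+ 2 - p.[y] * p^`()^`().[y].
Proof.
move=> [[|x l] pE] sp.
  by move: sp; rewrite pE big_nil ltnNge (leq_trans (size_scale_leq _ _)) ?size_poly1.
move: pE; rewrite big_cons; have := laguerre_ge0 l y; set f := \prod_(_ <- _) _.
move=> L pE; rewrite {}pE hornerZ hornerM !mulf_eq0 !negb_or => /and3P[c0 _ f0].
rewrite !derivZ deriv_XsubCM derivD deriv_XsubCM !hornerE.
set c := lead_coef p in c0 *.
rewrite [X in 0 < X](_ : _ = c ^+ 2 * (f.[y] ^+ 2 +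
    (y - x) ^+ 2 * (f^`().[y] ^+ 2 - f.[y] * f^`()^`().[y]))).
  rewrite mulr_gt0 ?exprn_even_gt0 // ltr_wpDr ?exprn_even_gt0 //.
  by rewrite mulr_ge0 ?sqr_ge0.
by rewrite /=; ring.
Qed.

End Rpoly.

(** * Simplicity of the roots of the convolution *)

Section Simple.
Variable R : realType.

Lemma fconv_monicE n (p q : {poly R}) : q \is monic -> size q = n.+1 ->
  exists2 r : {poly R}, fconv n p q = p + r & (size r <= (size p).-1)%N.
Proof.
move=> qm sq; have qn : q`_n = 1 by rewrite -(monicP qm) lead_coefE sq.
exists (\sum_(j < n) ((n - j.+1)`!%:R / n`!%:R * q`_(n - j.+1)) *: p^`(j.+1)).
  rewrite /fconv big_ord_recl /= subn0 divff ?fact_neq0 // qn mulr1 scale1r.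
  by rewrite ?derivn0; congr (_ + _); apply: eq_bigr.
apply: (leq_trans (size_sum _ _ _)); apply/bigmax_leqP => j _.
apply: (leq_trans (size_scale_leq _ _)); apply/leq_sizeP => k pk.
by rewrite coef_derivn nth_default ?mul0rn //; move: pk; case: (size p) => //= m; lia.
Qed.

Lemma lead_fconv n (p q : {poly R}) : q \is monic -> size q = n.+1 ->
  size (fconv n p q) = size p /\ lead_coef (fconv n p q) = lead_coef p.
Proof.
move=> qm sq; have [r -> sr] := fconv_monicE p qm sq.
have [p0|p0] := eqVneq p 0.
  move: sr; rewrite p0 size_poly0 /= leqn0 size_poly_eq0 => /eqP ->.
  by rewrite addr0 size_poly0.
have rp : (size r < size p)%N.
  by rewrite (leq_ltn_trans sr) // prednK // size_poly_gt0.
by rewrite size_polyDl // lead_coefDl.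
Qed.

(** Only the derivative of order [d] meets a nonzero coefficient of the monomial, and it is a
    nonzero constant. This is the perturbation direction used in [fconv_simple]. *)
Lemma fconv_Xn n d (p : {poly R}) : size p = d.+1 -> (d <= n)%N ->
  exists2 c : R, c != 0 & fconv n p 'X^(n - d) = c%:P.
Proof.
move=> sp dn; exists ((n - d)`!%:R / n`!%:R * (p`_d *+ d`!)).
  rewrite mulf_neq0 ?mulf_neq0 ?invr_eq0 ?fact_neq0 //.
  have : lead_coef p != 0 by rewrite lead_coef_eq0 -size_poly_eq0 sp.
  by rewrite lead_coefE sp /= -mulr_natr => p0; rewrite mulf_neq0 ?fact_neq0.
have dn1 : (d < n.+1)%N by [].
rewrite /fconv (bigD1 (Ordinal dn1)) //= coefXn eqxx mulr1 big1 ?addr0; last first.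
  move=> j jd; rewrite coefXn; case: eqP => [E|]; rewrite ?mulr0 ?scale0r //.
  move/negP: jd; case; apply/eqP/val_inj => /=; have := ltn_ord j; lia.
rewrite polyCM -mul_polyC; congr (_ * _); apply/polyP => k.
rewrite coef_derivn coefC; case: k => [|k]; first by rewrite addn0 ffactnn.
by rewrite nth_default ?mul0rn // sp addnS ltnS leq_addr.
Qed.

(* Perturbing the simple-rooted argument shifts the convolution by an arbitrary
   small constant of either sign, while Laguerre's inequality forbids one of the
   two signs at a double root. *)
Lemma fconv_simple n (p : {poly R}) (b : 'rV[R]_n) x : injective (b 0) ->
  realrooted p -> p != 0 -> (size p <= n.+1)%N ->
  (fconv n p (rpoly b)).[x] = 0 -> (fconv n p (rpoly b))^`().[x] != 0.
Proof.
move=> bI pr p0 sp; have [sk lk] := lead_fconv p (monic_rpoly b) (size_rpoly b).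
set k := fconv n p (rpoly b) in sk lk * => kx; apply/eqP => dkx.
have [d sd] : exists d, size p = d.+1.
  by exists (size p).-1; rewrite prednK // size_poly_gt0.
have dn : (d <= n)%N by rewrite -ltnS -sd.
have d0 : (0 < d)%N.
  case: d sd {dn} => // sd; have /size_poly1P[c c0 kE] : size k == 1 by rewrite sk sd.
  by move: kx; rewrite kE hornerC => c00; rewrite c00 eqxx in c0.
have [c c0 cE] := fconv_Xn sd dn.
have sX : (size ('X^(n - d) : {poly R}) <= n)%N by rewrite size_polyXn; lia.
(* At a double root [x] of [k], the perturbed polynomial has value $tc$ and zero derivative, so
   Laguerre's inequality collapses to this sign condition. It cannot hold for both $t=e/2$ and
   $t=-e/2$. *)
have key t : t != 0 -> (exists b' : 'rV[R]_n, rpoly b + t *: 'X^(n - d) = rpoly b') ->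
    0 < - (t * c * k^`()^`().[x]).
  move=> t0 [b' bE]; have KE : fconv n p (rpoly b') = k + (t * c)%:P.
    by rewrite -bE fconvDr fconvZr cE scale_polyC.
  have sK : (1 < size (k + (t * c)%:P)%R)%N.
    have [K _] := lead_fconv p (monic_rpoly b') (size_rpoly b').
    by rewrite -KE K sd ltnS.
  have Kr : realrooted (k + (t * c)%:P).
    by rewrite -KE rpolyE; apply: realrooted_fconv; rewrite ?size_entries.
  have Kx : (k + (t * c)%:P).[x] = t * c by rewrite !hornerE kx add0r.
  have := laguerre_gt0 Kr sK (y := x); rewrite Kx mulf_neq0 // => /(_ isT).
  by rewrite derivD derivC addr0 dkx expr0n /= sub0r.
have /nbhs_ballP[e /= e0 eP] := rpoly_perturb bI sX.
have e2 : 0 < e / 2 by rewrite divr_gt0.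
have inb s : `|s| = e / 2 -> ball (0 : R) e s.
  by move=> sE; rewrite -ball_normE /= sub0r normrN sE; lra.
have := key (e / 2) _ (eP _ (inb _ (gtr0_norm e2))).
have := key (- (e / 2)) _ (eP _ (inb _ _)).
rewrite normrN gtr0_norm // oppr_eq0 gt_eqF // => /(_ isT erefl).
by set u := _.[x] => h1 /(_ isT); nra.
Qed.

Lemma exists_sorted_rpoly n (p : {poly R}) : realrooted p -> p \is monic -> size p = n.+1 ->
  exists2 w : 'rV[R]_n, (forall i j : 'I_n, (i <= j)%N -> w 0 i <= w 0 j) & p = rpoly w.
Proof.
move=> [l pE] pm sp; move: pE; rewrite (monicP pm) scale1r => pE.
have sl : size l = n by apply/eq_add_S; rewrite -sp pE size_prod_XsubC.
have ss : size (sort <=%O l) = n by rewrite size_sort.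
exists (\row_i nth 0 (sort <=%O l) i).
  move=> i j ij; rewrite !mxE; apply: (sorted_leq_nth le_trans le_refl) => //.
  - exact: (sort_sorted le_total).
  - by rewrite inE ss.
  by rewrite inE ss.
rewrite pE -(perm_big _ (permEl (perm_sort <=%O l))) (big_nth 0) ss big_mkord.
by apply: eq_bigr => i _; rewrite mxE.
Qed.

Lemma boxplusC n (p q : {poly R}) : boxplus n p q = boxplus n q p.
Proof.
rewrite /boxplus; apply: eq_bigr => -[k kn] _ /=; congr ((_ * _) *: _).
rewrite /boxplus_coef (reindex_inj rev_ord_inj) /=.
apply: eq_bigr => -[i /= + _]; rewrite ltnS => ik; rewrite subSS subKn //.
by rewrite mulnC [acoef n p _ * _]mulrC.
Qed.

Lemma rpoly_injective n (w : 'rV[R]_n) :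
  (forall x, (rpoly w).[x] = 0 -> (rpoly w)^`().[x] != 0) -> injective (w 0).
Proof.
move=> simp i j wij; apply/eqP; apply: contraT => ij.
have := simp (w 0 i); rewrite /rpoly (bigD1 i) //= (bigD1 j) 1?eq_sym //= -wij /=.
rewrite deriv_XsubCM !hornerE subrr /= !mul0r addr0 => /(_ erefl).
by rewrite eqxx.

Qed.

End Simple.

(** * Differentiability of the roots *)

Section Caratheodory.
Variables (R : realType) (V : normedModType R).

Lemma differentiable_eps (f : V -> R) x (df : {linear V -> R}) : continuous df ->
  (forall e : R, 0 < e -> \forall h \near (0 : V), `|f (h + x) - f x - df h| <= e * `|h|) ->
  differentiable f x.
Proof.
move=> dfc H.
have E : f \o shift x = cst (f x) + df +o_ (0 : V) id.
  apply/eqaddoP => e e0; near=> h.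
  rewrite (_ : _ h = f (h + x) - f x - df h); first by near: h; exact: H.
  by rewrite /= !fctE /= opprD addrA.
apply/diff_locallyP; rewrite (diff_unique dfc E).
by split.
Unshelve. all: by end_near. Qed.

Lemma eps_differentiable (f : V -> R) x : differentiable f x ->
  forall e : R, 0 < e -> \forall h \near (0 : V), `|f (h + x) - f x - 'd f x h| <= e * `|h|.
Proof.
move=> /diff_locally /eqaddoP H e e0; have := H e e0.
by apply: filterS => h; rewrite !fctE /= opprD addrA.
Qed.

(* Carathéodory's form of the product rule: the second factor is only continuous. *)
Lemma differentiable_mul_continuous (f g k : V -> R) x : differentiable g x -> g x = 0 ->
  {for x, continuous k} -> (\forall y \near x, f y = f x + g y * k y) ->
  differentiable f x.
Proof.
move=> dg g0 kc fE.
have dgc := diff_continuous dg.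
have [K K0 KP] := linear_lipschitz dgc.
pose df : {linear V -> R} := (k x \*: 'd g x)%R.
apply: (@differentiable_eps f x df); first by move=> y; apply: continuousZl_tmp; exact: dgc.
move=> e e0; set c := k x.
have sh : (h + x) @[h --> (0 : V)] --> x.
  by rewrite -[X in _ --> X]add0r; apply: cvgD; [exact: cvg_id|exact: cvg_cst].
have c1 : 0 < `|c| + 1 by rewrite ltr_wpDl.
(* The error will be split as $(g-dg)\,k-dg\,(c-k)$. Half of [e] is divided by the bound [|c| + 1]
   on [k], the other half by the Lipschitz constant [K] of the differential of [g]. *)
have e1 : 0 < e / 2 / (`|c| + 1) by rewrite !divr_gt0.
have e2 : 0 < Num.min 1 (e / 2 / K) by rewrite lt_min ltr01 !divr_gt0.
have H1 := eps_differentiable dg e1; rewrite g0 in H1.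
have H2 : \forall h \near (0 : V), `|c - k (h + x)| < Num.min 1 (e / 2 / K).
  apply: (sh (fun y => `|c - k y| < Num.min 1 (e / 2 / K))).
  by move/cvgrPdist_lt: kc => /(_ _ e2).
have H3 : \forall h \near (0 : V), f (h + x) = f x + g (h + x) * k (h + x).
  exact: (sh _ fE).
near=> h.
have h1 : `|g (h + x) - 'd g x h| <= e / 2 / (`|c| + 1) * `|h|.
  have : `|g (h + x) - 0 - 'd g x h| <= e / 2 / (`|c| + 1) * `|h| by near: h.
  by rewrite subr0.
have h2 : `|c - k (h + x)| < Num.min 1 (e / 2 / K) by near: h.
have -> : f (h + x) = f x + g (h + x) * k (h + x) by near: h.
have [h3 h4] : `|c - k (h + x)| < 1 /\ `|c - k (h + x)| < e / 2 / K.
  by apply/andP; rewrite -lt_min.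
have kb : `|k (h + x)| <= `|c| + 1.
  rewrite (_ : k (h + x) = c - (c - k (h + x))); last by ring.
  by rewrite (le_trans (ler_normB _ _)) // lerD2l ltW.
have -> : f x + g (h + x) * k (h + x) - f x - df h =
    (g (h + x) - 'd g x h) * k (h + x) - 'd g x h * (c - k (h + x)).
  by rewrite /df /= -/c -[c *: _]/(c * _); ring.
rewrite (le_trans (ler_normB _ _)) // !normrM.
have -> : e * `|h| = e / 2 / (`|c| + 1) * `|h| * (`|c| + 1) + K * `|h| * (e / 2 / K).
  by field; rewrite !gt_eqF.
by rewrite lerD // ler_pM // ltW.
Unshelve. all: by end_near. Qed.

Lemma continuous_prod (I : Type) (s : seq I) (P : pred I) (f : I -> V -> R) x :
  (forall i, {for x, continuous (f i)}) ->
  {for x, continuous (fun y => \prod_(i <- s | P i) f i y)}.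
Proof.
move=> fc; elim: s => [|i s IH].
  rewrite (_ : (fun y => _) = cst 1); first exact: cst_continuous.
  by apply/funext => y; rewrite big_nil.
have [Pi|Pi] := boolP (P i); last first.
  by rewrite (_ : (fun y => _) = (fun y => \prod_(i <- s | P i) f i y)) //;
    apply/funext => y; rewrite big_cons (negPf Pi).
rewrite (_ : (fun y => _) = (fun y => f i y * \prod_(i <- s | P i) f i y)).
  by apply: continuousM => //; exact: fc.
by apply/funext => y; rewrite big_cons Pi.
Qed.

Lemma continuous_prodV (I : finType) (P : pred I) (f : I -> V -> R) (c : R) x :
  (forall i, {for x, continuous (f i)}) -> \prod_(i | P i) (c - f i x) != 0 ->
  {for x, continuous (fun y => - (\prod_(i | P i) (c - f i y))^-1)}.
Proof.
move=> fc p0; apply: (@continuousN _ _ _ (fun y => (\prod_(i | P i) (c - f i y))^-1)).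
apply: continuousV => //; apply: (@continuous_prod _ _ _ (fun i y => c - f i y)) => i.
by apply: continuousB; [exact: cst_continuous|exact: fc].
Qed.
End Caratheodory.

Section Increasing.
Variable R : realType.
Definition increasing n (w : 'rV[R]_n) := forall i j : 'I_n, (i < j)%N -> w 0 i < w 0 j.

Lemma increasing_le n (w : 'rV[R]_n) : increasing w ->
  forall i j : 'I_n, (i <= j)%N -> w 0 i <= w 0 j.
Proof.
move=> wi i j; rewrite leq_eqVlt => /orP[/eqP/val_inj -> //|/wi /ltW].
exact.
Qed.

Lemma increasing_inj n (w : 'rV[R]_n) : increasing w -> injective (w 0).
Proof.
move=> wi i j wij; case: (ltngtP i j) => [/wi|/wi|/val_inj//];
  by rewrite wij ltxx.
Qed.
End Increasing.

Section DifferentiableCoef.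
Variable R : realType.

Lemma differentiable_sumf (I : finType) m (f : I -> 'rV[R]_m -> R) (x : 'rV[R]_m) :
  (forall i, differentiable (f i) x) -> differentiable (fun y => \sum_i f i y) x.
Proof.
move=> df; rewrite (_ : (fun y => _) = \sum_(i < #|I|) f (enum_val i)).
  by apply: differentiable_sum.
apply/funext => y; rewrite fct_sumE (reindex_onto enum_val enum_rank) /=.
  by apply: eq_bigl => i; rewrite enum_valK eqxx.
by move=> i _; exact: enum_rankK.
Qed.

Lemma differentiable_coef_prod m (l : seq 'I_m) k (x : 'rV[R]_m) :
  differentiable (fun y : 'rV[R]_m => (\prod_(i <- l) ('X - (y 0 i)%:P))`_k) x.
Proof.
elim: l k => [|i l IH] k.
  rewrite (_ : (fun y => _) = cst ((1 : {poly R})`_k)); first exact: differentiable_cst.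
  by apply/funext => y; rewrite big_nil.
rewrite (_ : (fun y => _) =
  (fun y : 'rV[R]_m => if k is k'.+1 then (\prod_(j <- l) ('X - (y 0 j)%:P))`_k' else 0)
   - (fun y : 'rV[R]_m => y 0 i) * (fun y : 'rV[R]_m => (\prod_(j <- l) ('X - (y 0 j)%:P))`_k)).
  apply: differentiableB; first by case: k => [|k]; [exact: differentiable_cst|exact: IH].
  by apply: differentiableM; [exact: differentiable_coord|exact: IH].
apply/funext => y; rewrite big_cons mulrBl coefB coefXM coefCM.
by rewrite !fctE; case: k => [|k].
Qed.

End DifferentiableCoef.

(** * The ordered roots of the convolution as functions of the pair *)

Section Roots.
Variables (R : realType) (n : nat).
Implicit Types x y : 'rV[R]_(n + n).

Definition convp x : {poly R} := boxplus n (rpoly (lsubmx x)) (rpoly (rsubmx x)).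
Definition roots_of x : 'rV[R]_n := Omega (lsubmx x) (rsubmx x).
(* Simplicity of one argument suffices for the convolution to be simple. *)
Definition one_simple x := injective ((lsubmx x : 'rV[R]_n) 0) \/ injective ((rsubmx x : 'rV[R]_n) 0).

Lemma convpE x : convp x = fconv n (rpoly (lsubmx x)) (rpoly (rsubmx x)).
Proof. by rewrite /convp boxplusE // size_rpoly. Qed.

Lemma convp_monic x : convp x \is monic.
Proof.
rewrite convpE monicE; have [_ ->] := lead_fconv (rpoly (lsubmx x))
  (monic_rpoly (rsubmx x)) (size_rpoly _).
exact: monic_rpoly.
Qed.

Lemma size_convp x : size (convp x) = n.+1.
Proof.
rewrite convpE; have [-> _] := lead_fconv (rpoly (lsubmx x))
  (monic_rpoly (rsubmx x)) (size_rpoly _).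
exact: size_rpoly.
Qed.

Lemma realrooted_convp x : realrooted (convp x).
Proof.
rewrite convpE [X in fconv _ _ X]rpolyE; apply: realrooted_fconv.
- exact: size_entries.
- by rewrite size_rpoly.
- exact: monic_neq0 (monic_rpoly _).
- exact: realrooted_rpoly.
Qed.

Lemma convp_roots x : convp x = rpoly (roots_of x).
Proof.
have [w wS wE] := exists_sorted_rpoly (realrooted_convp x) (convp_monic x) (size_convp x).
rewrite /roots_of /Omega (ordered_rootsP wS) //; exact: wE.
Qed.

Lemma roots_of_le x (i j : 'I_n) : (i <= j)%N -> roots_of x 0 i <= roots_of x 0 j.
Proof.
have [w wS wE] := exists_sorted_rpoly (realrooted_convp x) (convp_monic x) (size_convp x).
by rewrite /roots_of /Omega (ordered_rootsP wS) //; apply: wS.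
Qed.

Lemma roots_of_unique x (w : 'rV[R]_n) : (forall i j : 'I_n, (i <= j)%N -> w 0 i <= w 0 j) ->
  convp x = rpoly w -> roots_of x = w.
Proof. exact: ordered_rootsP. Qed.

Lemma one_simple_increasing x : one_simple x -> increasing (roots_of x).
Proof.
move=> gx; have simp z : (rpoly (roots_of x)).[z] = 0 -> (rpoly (roots_of x))^`().[z] != 0.
  rewrite -convp_roots; case: gx => inj.
    rewrite /convp boxplusC boxplusE ?size_rpoly //; apply: fconv_simple => //.
    - exact: realrooted_rpoly.
    - exact: monic_neq0 (monic_rpoly _).
    - by rewrite size_rpoly.
  rewrite convpE; apply: fconv_simple => //.
  - exact: realrooted_rpoly.
  - exact: monic_neq0 (monic_rpoly _).
  - by rewrite size_rpoly.
have rinj := rpoly_injective simp.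
move=> i j ij; rewrite lt_neqAle roots_of_le ?andbT ?(ltnW ij) //.
by apply: contraTneq ij => /rinj ->; rewrite ltnn.
Qed.

Lemma differentiable_convp t x : differentiable (fun y => (convp y).[t]) x.
Proof.
have dl k : differentiable (fun y : 'rV[R]_(n + n) => acoef n (rpoly (lsubmx y : 'rV[R]_n)) k) x.
  rewrite (_ : (fun y => _) = (fun y : 'rV[R]_(n + n) => (-1) ^+ k *
     (\prod_(i <- map (lshift n) (enum 'I_n)) ('X - (y 0 i)%:P))`_(n - k))).
    apply: (@differentiableZ _ _ _ (fun y : 'rV[R]_(n + n) =>
      (\prod_(i <- map (lshift n) (enum 'I_n)) ('X - (y 0 i)%:P))`_(n - k))).
    exact: differentiable_coef_prod.
  apply/funext => y; rewrite /acoef rpolyE.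
  rewrite (_ : entries _ = [seq y 0 i | i <- map (lshift n) (enum 'I_n)]).
    by rewrite big_map.
  by rewrite -map_comp; apply: eq_map => i; rewrite /= mxE.
have dr k : differentiable (fun y : 'rV[R]_(n + n) => acoef n (rpoly (rsubmx y : 'rV[R]_n)) k) x.
  rewrite (_ : (fun y => _) = (fun y : 'rV[R]_(n + n) => (-1) ^+ k *
     (\prod_(i <- map (@rshift n n) (enum 'I_n)) ('X - (y 0 i)%:P))`_(n - k))).
    apply: (@differentiableZ _ _ _ (fun y : 'rV[R]_(n + n) =>
      (\prod_(i <- map (@rshift n n) (enum 'I_n)) ('X - (y 0 i)%:P))`_(n - k))).
    exact: differentiable_coef_prod.
  apply/funext => y; rewrite /acoef rpolyE.
  rewrite (_ : entries _ = [seq y 0 i | i <- map (@rshift n n) (enum 'I_n)]).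
    by rewrite big_map.
  by rewrite -map_comp; apply: eq_map => i; rewrite /= mxE.
rewrite (_ : (fun y => _) = (fun y => \sum_(k < n.+1) ((-1) ^+ k * t ^+ (n - k)) *
   boxplus_coef n (rpoly (lsubmx y)) (rpoly (rsubmx y)) k)); last first.
  apply/funext => y; rewrite /convp horner_sum; apply: eq_bigr => k _.
  by rewrite hornerZ hornerXn mulrAC.
apply: differentiable_sumf => k.
apply: (@differentiableZ _ _ _ (fun y => boxplus_coef n (rpoly (lsubmx y)) (rpoly (rsubmx y)) k)).
apply: differentiable_sumf => i.
apply: (@differentiableZ _ _ _
  (fun y => acoef n (rpoly (lsubmx y)) i * acoef n (rpoly (rsubmx y)) (k - i))).
by apply: (@differentiableM _ _ (fun y => acoef n (rpoly (lsubmx y)) i)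
  (fun y => acoef n (rpoly (rsubmx y)) (k - i))).
Qed.

(** The sign changes of [convp x] around its simple roots persist for nearby [y]. The roots of
    [convp y] so found lie in disjoint intervals, hence are already in increasing order and are the
    entries of [roots_of y]. *)
Lemma roots_of_near x e : increasing (roots_of x) -> 0 < e ->
  \forall y \near x, increasing (roots_of y) /\
     forall k, `|roots_of y 0 k - roots_of x 0 k| < e.
Proof.
move=> gx e0; set g := roots_of x.
have [e1 e10 gap1] := exists_gap (increasing_inj gx).
have [e2 [e20 gap e2e]] : exists e2, [/\ 0 < e2,
    forall i j, i != j -> e2 *+ 2 < `|g 0 i - g 0 j| & e2 <= e].
  exists (Num.min e e1); split; rewrite ?lt_min ?e0 ?e10 ?ge_min ?lexx //.
  move=> i j /gap1; apply: le_lt_trans; rewrite lerMn2r /=.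
  by rewrite ge_min lexx orbT.
have H : \forall y \near x, forall k,
    (convp y).[g 0 k - e2] * (convp y).[g 0 k + e2] < 0.
  apply: (@filter_forall _ _ _ _ (nbhs_filter x)) => k.
  have c1 := differentiable_continuous (differentiable_convp (g 0 k - e2) x).
  have c2 := differentiable_continuous (differentiable_convp (g 0 k + e2) x).
  have : (convp y).[g 0 k - e2] * (convp y).[g 0 k + e2] @[y --> x] -->
      (convp x).[g 0 k - e2] * (convp x).[g 0 k + e2] by exact: cvgM c1 c2.
  move/cvgr_lt; apply.
  by rewrite convp_roots; exact: rpoly_sign.
apply: filterS H => y Hy.
have [b' bE bn] := rpoly_near e20 gap (convp_monic y) (size_convp y) Hy.
have bi : increasing b'.
  move=> i j ij; have gij := gx _ _ ij; rewrite -/g in gij.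
  have ij' : j != i by apply: contraTneq ij => ->; rewrite ltnn.
  have := gap _ _ ij'; rewrite gtr0_norm ?subr_gt0 // mulr2n => gp.
  have := bn i; have := bn j; rewrite !ltr_norml => /andP[? ?] /andP[? ?]; lra.
rewrite (roots_of_unique (increasing_le bi) bE); split=> // k.
exact: lt_le_trans (bn k) e2e.
Qed.

Lemma continuous_roots_of x k : increasing (roots_of x) ->
  {for x, continuous (fun y => roots_of y 0 k)}.
Proof.
move=> gx; pose f (y : 'rV[R]_(n + n)) := roots_of y 0 k.
suff : f @ nbhs x --> f x by [].
apply: (proj2 (@cvgrPdist_lt _ _ _ (nbhs x) (nbhs_filter x) f (f x))) => e e0.
apply: (@filterS _ _ (nbhs_filter x) _ _ _ (roots_of_near gx e0)) => y [_ /(_ k)].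
by rewrite distrC.
Qed.

(** Evaluate the factorization of [convp y] at the old root and solve for the factor with index [k].
    In place of an implicit function theorem, this is the product fed to
    [differentiable_mul_continuous]: the first factor is differentiable, and continuity of the roots
    suffices for the second. *)
Lemma roots_of_increment x : increasing (roots_of x) -> forall k,
  \forall y \near x, roots_of y 0 k = roots_of x 0 k +
    (convp y).[roots_of x 0 k] * - (\prod_(l < n | l != k) (roots_of x 0 k - roots_of y 0 l))^-1.
Proof.
move=> gx k; set g := roots_of x.
have [e e0 gap] := exists_gap (increasing_inj gx).
apply: (@filterS _ _ (nbhs_filter x) _ _ _ (roots_of_near gx e0)) => y [_ yn].
rewrite convp_roots horner_rpoly (bigD1 k) //=.
set P := \prod_(_ < n | _) _.
have P0 : P != 0.
  apply/prodf_neq0 => l lk; rewrite subr_eq0; apply: contraTneq (yn l) => <-.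
  rewrite -leNgt ltW // (le_lt_trans _ (gap _ _ _)) // ?mulr2n ?lerDl ?ltW //.
  by rewrite eq_sym.
by field.
Qed.

Lemma differentiable_root x k : increasing (roots_of x) ->
  differentiable (fun y => roots_of y 0 k) x.
Proof.
move=> gx; apply: (differentiable_mul_continuous
  (differentiable_convp (roots_of x 0 k) x) _ _ (roots_of_increment gx k)).
  by rewrite convp_roots horner_rpoly (bigD1 k) //= subrr mul0r.
apply: continuous_prodV => [l|]; first exact: continuous_roots_of.
apply/prodf_neq0 => l lk; rewrite subr_eq0; apply: contra_neq lk => E.
exact/esym/(increasing_inj gx).
Qed.

Lemma differentiable_roots_of x : increasing (roots_of x) -> differentiable roots_of x.
Proof.
move=> gx; rewrite (_ : roots_of = \sum_(k < n) (fun y => roots_of y 0 k *: delta_mx 0 k)).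
  apply: differentiable_sum => k.
  by apply: differentiableZl; exact: differentiable_root.
by apply/funext => y; rewrite fct_sumE -row_sum_delta.
Qed.

End Roots.

(** * The orbit of root curves is traced by a polynomial of bounded degree *)

Section Zeros.
Variable R : realType.

Lemma continuous_eq_off (f g : R -> R) a : {for a, continuous f} -> {for a, continuous g} ->
  (forall s, s != a -> f s = g s) -> f a = g a.
Proof.
move=> fc gc fg.
have f1 : f @ a^' --> f a by apply/continuous_withinNx.
have g1 : g @ a^' --> g a by apply/continuous_withinNx.
have f2 : f @ a^' --> g a.
  apply: cvg_trans g1; apply: near_eq_cvg; near=> s; apply/esym/fg; near: s.
  exact: nbhs_dnbhs_neq.
exact: (cvg_unique _ f1 f2).
Unshelve. all: by end_near. Qed.

(** The [z i] may coincide, so roots are removed one at a time: cancelling a factor gives the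
    identity away from [z i], and continuity of [Psi] restores it there. *)
Lemma poly_factor_continuous (I : Type) (l : seq I) (z : I -> R) (Psi : R -> R) (D : {poly R}) :
  continuous Psi -> (forall s, D.[s] = \prod_(i <- l) (s - z i) * Psi s) ->
  exists2 E : {poly R}, D = \prod_(i <- l) ('X - (z i)%:P) * E & forall s, E.[s] = Psi s.
Proof.
move=> Pc; elim: l D => [|i l IH] D DE.
  by exists D; rewrite ?big_nil ?mul1r // => s; rewrite DE big_nil mul1r.
have : root D (z i) by rewrite /root DE big_cons subrr !mul0r.
move=> /factor_theorem [D1 D1E].
have [|E EE EP] := IH D1; last first.
  by exists E => //; rewrite big_cons D1E EE mulrC mulrA.
have off s : s != z i -> D1.[s] = \prod_(j <- l) (s - z j) * Psi s.
  move=> si; have := DE s; rewrite D1E hornerM hornerXsubC big_cons mulrC -mulrA.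
  by apply: mulfI; rewrite subr_eq0.
move=> s; have [->|] := eqVneq s (z i); last exact: off.
apply: (@continuous_eq_off (horner D1) (fun s => \prod_(j <- l) (s - z j) * Psi s)) => //.
  exact: continuous_horner.
apply: continuousM; last exact: Pc.
by apply: continuous_prod => j; apply: continuousB; [exact: cvg_id|exact: cst_continuous].
Qed.

Lemma continuous_slope (f : R -> R) z : continuous f -> derivable f z 1 -> f z = 0 ->
  exists2 g : R -> R, continuous g & forall s, f s = (s - z) * g s.
Proof.
move=> fc fd fz; pose g s := if s == z then 'D_1 f z else f s / (s - z).
exists g; last first.
  move=> s; rewrite /g; case: eqP => [->|/eqP sz]; first by rewrite subrr mul0r.
  by rewrite mulrCA mulfV ?mulr1 // subr_eq0.
move=> s; have [->|sz] := eqVneq s z; last first.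
  have h : {for s, continuous (fun t => f t / (t - z))}.
    apply: continuousM; first exact: fc.
    apply: continuousV; first by rewrite subr_eq0.
    by apply: continuousB; [exact: cvg_id|exact: cst_continuous].
  have gs : g s = f s / (s - z) by rewrite /g (negPf sz).
  suff : g @ s --> g s by [].
  rewrite gs; apply: cvg_trans h; apply: near_eq_cvg.
  have : \forall t \near s, t != z.
    apply: open_nbhs_nbhs; split; last exact: sz.
    by apply: open_neq.
  by apply: filterS => t tz; rewrite /g (negPf tz).
apply/continuous_withinNx.
have gz : g z = 'D_1 f z by rewrite /g eqxx.
rewrite gz; have /cvg_ex [l fl] := fd; have -> : 'D_1 f z = l by apply/cvg_lim.
apply/cvgrPdist_lt => e e0; move/cvgrPdist_lt: fl => /(_ e e0).
rewrite !near_withinE => /nbhs_ballP [d /= d0 dP].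
apply/nbhs_ballP; exists d => // t; rewrite -ball_normE /= => zt tz.
have := dP (t - z); rewrite -ball_normE /= sub0r normrN distrC subr_eq0 => /(_ zt tz).
by rewrite /g (negPf tz) /= scaler1 subrK fz subr0 mulrC.
Qed.

(** Write each [phi i] as [s - z i] times a continuous [g i]. Then [D] is the product of the
    ['X - (z i)%:P] times a polynomial [E], constant by the degree bound. The extra zero [z']
    annihilates [g i0], hence [E]. *)
Lemma zeros_bound (I : finType) (phi : I -> R -> R) (z : I -> R) (D : {poly R}) i0 z' :
  (forall i, continuous (phi i)) -> (forall i, derivable (phi i) (z i) 1) ->
  (forall i, phi i (z i) = 0) -> (forall s, D.[s] = \prod_i phi i s) ->
  (size D <= #|I|.+1)%N -> phi i0 z' = 0 -> z' != z i0 -> D = 0.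
Proof.
move=> phc phd phz DE sD ph0 zz.
have /choice [g gP] : forall i, exists g, continuous g /\ forall s, phi i s = (s - z i) * g s.
  move=> i; have [g ? ?] := continuous_slope (phc i) (phd i) (phz i).
  by exists g.
have [||E DEq EP] := @poly_factor_continuous I (index_enum I) z (fun s => \prod_i g i s) D.
- by move=> s; apply: continuous_prod => i; case: (gP i) => gc _; exact: gc.
- move=> s; rewrite DE -big_split; apply: eq_bigr => i _; by case: (gP i).
have [E0|E0] := eqVneq E 0; first by rewrite DEq E0 mulr0.
have sE : size E == 1%N.
  rewrite eqn_leq size_poly_gt0 E0 andbT; move: sD.
  rewrite DEq size_proper_mul; last first.
    by rewrite (monicP (monic_prod_XsubC _ _ _)) mul1r lead_coef_eq0.
  have -> : size (\prod_(i : I) ('X - (z i)%:P)) = #|I|.+1.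
    by rewrite size_prod_XsubC /index_enum -enumT cardE.
  lia.
have /size_poly1P [c c0 Ec] := sE.
have g0 : g i0 z' = 0.
  have := (gP i0).2 z'; rewrite ph0 => /esym/eqP.
  by rewrite mulf_eq0 subr_eq0 (negPf zz) => /eqP.
have := EP z'; rewrite (bigD1 i0) //= g0 mul0r Ec hornerC => c0'.
by rewrite c0' eqxx in c0.
Qed.
End Zeros.

(** * Coefficients along a line of roots and under scaling *)

Section CoefLine.
Variable R : realType.

Lemma boxplus_coefE n (p q : {poly R}) j : (j <= n)%N ->
  (boxplus n p q)`_(n - j) = (-1) ^+ j * boxplus_coef n p q j.
Proof.
move=> jn; rewrite /boxplus coef_sum.
under eq_bigr => k _ do rewrite coefZ coefXn.
have jn1 : (j < n.+1)%N by [].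
rewrite (bigD1 (Ordinal jn1)) //= eqxx mulr1 big1 ?addr0 // => k kj.
case: eqP => [E|]; rewrite ?mulr0 //; case/negP: kj; apply/eqP/val_inj => /=.
by have := ltn_ord k; lia.
Qed.

(** Each factor chosen for its constant term adds one degree in [s], and the coefficient of $X^k$
    takes [size l - k] of them. Above [size l] the truncated bound is 0 and forces [E] to vanish. *)
Lemma coef_prod_line I (l : seq I) (a b : I -> R) k :
  exists2 E : {poly R}, (size E <= (size l).+1 - k)%N &
    forall s, (\prod_(i <- l) ('X - (a i + s * b i)%:P))`_k = E.[s].
Proof.
elim: l k => [|i l IH] k.
  exists ((k == 0%N)%:R%:P); last by move=> s; rewrite big_nil coef1 hornerC.
  by rewrite size_polyC; case: k => [|k] //=; rewrite ?oner_eq0 ?eqxx.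
have [E1 s1 E1P] := IH k.
have [E0 s0 E0P] : exists2 E : {poly R}, (size E <= (size l).+2 - k)%N &
    forall s, ('X * \prod_(i <- l) ('X - (a i + s * b i)%:P))`_k = E.[s].
  case: k {E1 s1 E1P} => [|k]; first by exists 0 => [|s]; rewrite ?size_poly0 ?coefXM ?horner0.
  by have [E sE EP] := IH k; exists E; [rewrite subSS|move=> s; rewrite coefXM /= EP].
exists (E0 - ((a i)%:P + b i *: 'X) * E1).
  rewrite (leq_trans (size_polyD _ _)) // geq_max s0 size_polyN /=.
  have [->|E10] := eqVneq E1 0; first by rewrite mulr0 size_poly0.
  have h1 : (0 < size E1)%N by rewrite size_poly_gt0.
  have h2 : (size ((a i)%:P + b i *: 'X)%R <= 2)%N.
    rewrite (leq_trans (size_polyD _ _)) // geq_max (leq_trans (size_polyC_leq1 _)) //.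
    by rewrite (leq_trans (size_scale_leq _ _)) // size_polyX.
  by apply: leq_trans (size_polyMleq _ _) _; lia.
by move=> s; rewrite big_cons mulrBl coefB E0P coefCM E1P !hornerE /=; ring.
Qed.

Lemma coef_prod_scale I (l : seq I) (a : I -> R) c k :
  (\prod_(i <- l) ('X - (c * a i)%:P))`_k =
  c ^+ (size l - k) * (\prod_(i <- l) ('X - (a i)%:P))`_k.
Proof.
elim: l k => [|i l IH] k.
  by rewrite !big_nil coef1 sub0n expr0 mul1r.
rewrite !big_cons !mulrBl !coefB !coefXM !coefCM !IH /= mulrBr.
congr (_ - _); first by case: k => [|k]; rewrite ?mulr0 // subSS.
have [kl|lk] := leqP k (size l); last first.
  by rewrite nth_default ?size_prod_XsubC // !mulr0.
by rewrite subSn // exprS; ring.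
Qed.

(** Newton's identity $2e_2=p_1^2-p_2$, which converts second coefficients into sums of squares of
    roots. *)
Lemma coef2_prod_XsubC (l : seq R) k : size l = k.+2 ->
  2 * (\prod_(x <- l) ('X - x%:P))`_k = (\sum_(x <- l) x) ^+ 2 - \sum_(x <- l) x ^+ 2.
Proof.
elim: l k => // c l IH k [sl]; rewrite !big_cons mulrBl coefB coefXM coefCM.
have -> : (\prod_(x <- l) ('X - x%:P))`_k = - \sum_(x <- l) x.
  by rewrite -[k]/(k.+1.-1) -sl coefPn_prod_XsubC // sl.
case: k sl => [|k] sl /=; last first.
  by rewrite mulrBr IH //; ring.
case: l sl {IH} => [|d [|]] //= _; rewrite !big_seq1; ring.
Qed.
End CoefLine.

(** * The convolution along lines, under scaling and shifts, and its first two moments *)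

Section Lines.
Variables (R : realType) (n : nat).
Implicit Types x v : 'rV[R]_(n + n).
Local Notation ones := (const_mx 1 : 'rV[R]_n).

(** In $c_j$ the factors $a_i$ and $b_{j-i}$ have degree at most $i$ and $j-i$ in [s]; the total $j$
    is the bound that [orbit_prod_poly] asks for. *)
Lemma convp_line x v : exists E : nat -> {poly R},
  (forall s j, (j <= n)%N -> (convp (x + s *: v))`_(n - j) = (E j).[s]) /\
  (forall j, (size (E j) <= j.+1)%N).
Proof.
have ac (a b : 'rV[R]_n) : exists E : nat -> {poly R},
    (forall s j, (j <= n)%N -> acoef n (rpoly (a + s *: b)) j = (E j).[s]) /\
    (forall j, (j <= n)%N -> (size (E j) <= j.+1)%N).
  have /choice [E EP] : forall j, exists E : {poly R}, (size E <= n.+1 - (n - j))%N /\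
      forall s, (rpoly (a + s *: b))`_(n - j) = E.[s].
    move=> j; have [E sE EP] := coef_prod_line (enum 'I_n) (a 0) (b 0) (n - j).
    exists E; split; first by rewrite size_enum_ord in sE.
    by move=> s; rewrite -EP rpolyE big_map; under eq_bigr do rewrite !mxE.
  exists (fun j => (-1) ^+ j *: E j); split=> [s j jn|j jn].
    by rewrite hornerZ /acoef; case: (EP j) => _ ->.
  by rewrite (leq_trans (size_scale_leq _ _)) //; case: (EP j) => + _; lia.
have [E1 [E1P s1]] := ac (lsubmx x) (lsubmx v).
have [E2 [E2P s2]] := ac (rsubmx x) (rsubmx v).
exists (fun j => if (j <= n)%N then (-1) ^+ j *: \sum_(i < j.+1)
   (((n - i)`! * (n - (j - i))`!)%:R / (n`! * (n - j)`!)%:R) *: (E1 i * E2 (j - i)%N) else 0).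
split=> [s j jn|j].
  rewrite jn /convp boxplus_coefE // hornerZ horner_sum; congr (_ * _).
  rewrite /boxplus_coef; apply: eq_bigr => -[i /=]; rewrite ltnS => ij _.
  rewrite hornerZ hornerM -E1P ?(leq_trans ij) // -E2P ?(leq_trans (leq_subr _ _)) //.
  by rewrite !linearD !linearZ.
case: (leqP j n) => jn; last by rewrite /= size_poly0.
rewrite (leq_trans (size_scale_leq _ _)) //.
apply: (leq_trans (size_sum _ _ _)); apply/bigmax_leqP => -[i /=]; rewrite ltnS => ij _.
rewrite (leq_trans (size_scale_leq _ _)) // (leq_trans (size_polyMleq _ _)) //.
have := s1 _ (leq_trans ij jn); have := s2 _ (leq_trans (leq_subr i j) jn); lia.
Qed.

Lemma rpoly_scale (a : 'rV[R]_n) c k : (k <= n)%N ->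
  (rpoly (c *: a))`_(n - k) = c ^+ k * (rpoly a)`_(n - k).
Proof.
move=> kn; rewrite !rpolyE !big_map.
under eq_bigr do rewrite mxE.
by rewrite coef_prod_scale -enumT size_enum_ord subKn.
Qed.

Lemma convp_scale x c : convp (c *: x) = rpoly (c *: roots_of x).
Proof.
apply/polyP => m; have [mn|nm] := leqP m n; last first.
  by rewrite !nth_default ?size_convp ?size_rpoly.
rewrite -(subKn mn); have := leq_subr m n; move: (n - m)%N => j jn.
rewrite rpoly_scale // -convp_roots /convp !boxplus_coefE // mulrCA; congr (_ * _).
rewrite /boxplus_coef mulr_sumr; apply: eq_bigr => -[i /=]; rewrite ltnS => ij _.
rewrite !linearZ /= /acoef !rpoly_scale ?(leq_trans ij) ?(leq_trans (leq_subr _ _)) //.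
by rewrite -(subnKC ij) exprD addKn; ring.
Qed.

Lemma roots_of_scale x c : 0 <= c -> roots_of (c *: x) = c *: roots_of x.
Proof.
move=> c0; apply: roots_of_unique (convp_scale x c) => i j ij.
by rewrite !mxE ler_wpM2l // roots_of_le.
Qed.

Lemma roots_of_opp x k : roots_of (- x) 0 k = - roots_of x 0 (rev_ord k).
Proof.
pose w : 'rV[R]_n := \row_k - roots_of x 0 (rev_ord k).
suff -> : roots_of (- x) = w by rewrite mxE.
apply: roots_of_unique => [i j ij|].
  by rewrite !mxE lerN2 roots_of_le //= leq_sub2l.
rewrite -scaleN1r convp_scale /rpoly (reindex_inj rev_ord_inj) /=.
by apply: eq_bigr => i _; rewrite !mxE mulN1r.
Qed.

Lemma rpoly_shift (a : 'rV[R]_n) c : rpoly (a + c *: ones) = rpoly a \Po ('X - c%:P).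
Proof.
rewrite /rpoly rmorph_prod /=; apply: eq_bigr => i _.
by rewrite !mxE mulr1 rmorphB /= comp_polyX comp_polyC polyCD; ring.
Qed.

Lemma roots_of_shift x c d :
  roots_of (x + row_mx (c *: ones) (d *: ones)) = roots_of x + (c + d) *: ones.
Proof.
apply: roots_of_unique => [i j ij|]; first by rewrite !mxE lerD2r roots_of_le.
have shl (p : {poly R}) (a : 'rV[R]_n) e : (size p <= n.+1)%N ->
    boxplus n (rpoly (a + e *: ones)) p = boxplus n (rpoly a) p \Po ('X - e%:P).
  by move=> sp; rewrite !boxplusE ?size_rpoly // rpoly_shift fconv_translate.
rewrite /convp !linearD /= row_mxKl row_mxKr shl ?size_rpoly //.
rewrite boxplusC shl ?size_rpoly // boxplusC -/(convp x) convp_roots -!rpoly_shift.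
by congr rpoly; rewrite -addrA -scalerDl addrC [d + c]addrC addrC.
Qed.

Lemma sum_roots_of x : (0 < n)%N ->
  \sum_k roots_of x 0 k = \sum_k (lsubmx x : 'rV_n) 0 k + \sum_k (rsubmx x : 'rV_n) 0 k.
Proof.
move=> n0; have c1 (a : 'rV[R]_n) : (rpoly a)`_(n - 1) = - \sum_k a 0 k.
  have -> : (n - 1 = (size (entries a)).-1)%N by rewrite size_entries subn1.
  rewrite rpolyE coefPn_prod_XsubC ?size_entries -?lt0n //.
  by rewrite big_map big_enum.
have := congr1 (fun p : {poly R} => p`_(n - 1)) (convp_roots x).
rewrite c1 /convp boxplus_coefE // /boxplus_coef big_ord_recl big_ord1 /= /acoef.
rewrite -[bump 0 0]/1%N subnn !subn0 !c1.
have top (a : 'rV[R]_n) : (rpoly a)`_n = 1.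
  by have /monicP := monic_rpoly a; rewrite lead_coefE size_rpoly.
have F : (n`! * (n - 1)`!)%:R != 0 :> R by rewrite natrM mulf_neq0 ?fact_neq0.
rewrite !top [((n - 1)`! * n`!)%N]mulnC !divff //.
rewrite !expr1 expr0 => H; apply: oppr_inj; rewrite -H; ring.
Qed.

(** Additivity of the variance: for vanishing means the cross term $a_1b_1$ drops out and
    $c_2=a_2+b_2$, which Newton's identity turns into sums of squares. *)
Lemma sqr_roots_of x : (1 < n)%N -> \sum_k (lsubmx x : 'rV_n) 0 k = 0 ->
  \sum_k (rsubmx x : 'rV_n) 0 k = 0 -> dot (roots_of x) (roots_of x) = dot x x.
Proof.
move=> n1 l0 r0.
have c2 (a : 'rV[R]_n) : 2 * (rpoly a)`_(n - 2) = (\sum_k a 0 k) ^+ 2 - dot a a.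
  rewrite rpolyE coef2_prod_XsubC ?size_entries; last by lia.
  have -> : dot a a = \sum_k a 0 k ^+ 2 by apply: eq_bigr => k _; rewrite expr2.
  by rewrite big_map big_enum big_map big_enum.
have c1 (a : 'rV[R]_n) : \sum_k a 0 k = 0 -> (rpoly a)`_(n - 1) = 0.
  move=> a0; have -> : (n - 1 = (size (entries a)).-1)%N by rewrite size_entries subn1.
  rewrite rpolyE coefPn_prod_XsubC ?size_entries; last by lia.
  by rewrite big_map big_enum /= a0 oppr0.
have s0 : \sum_k roots_of x 0 k = 0 by rewrite sum_roots_of ?l0 ?r0 ?addr0 //; lia.
have := congr1 (fun p : {poly R} => 2 * p`_(n - 2)) (convp_roots x).
rewrite c2 s0 /convp boxplus_coefE // /boxplus_coef !big_ord_recl big_ord0 /= /acoef.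
rewrite -[bump 0 (bump 0 0)]/2%N -[bump 0 0]/1%N subnn !subn0 -[(2 - 1)%N]/1%N !c1 //.
have top (a : 'rV[R]_n) : (rpoly a)`_n = 1.
  by have /monicP := monic_rpoly a; rewrite lead_coefE size_rpoly.
have F : (n`! * (n - 2)`!)%:R != 0 :> R by rewrite natrM mulf_neq0 ?fact_neq0.
rewrite !top [((n - 2)`! * n`!)%N]mulnC !divff //.
have -> : dot x x = dot (lsubmx x : 'rV_n) (lsubmx x) + dot (rsubmx x : 'rV_n) (rsubmx x).
  by rewrite /dot big_split_ord; congr (_ + _); apply: eq_bigr => i _; rewrite !mxE.
have := c2 (lsubmx x); have := c2 (rsubmx x); rewrite l0 r0.
by move=> h1 h2; lra.
Qed.

End Lines.

(** * Root curves along a line and the sign of their weighted speed *)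

Section Speed.
Variables (R : realType) (n : nat).
Implicit Types x v : 'rV[R]_(n + n).

Definition root_curve x v (k : 'I_n) (s : R) : R := roots_of (x + s *: v) 0 k.
Definition root_speed x v (k : 'I_n) : R := 'D_1 (root_curve x v k) 0.

Lemma differentiable_line x v s : differentiable (fun t : R => x + t *: v) s.
Proof.
apply: (@differentiableD _ _ _ (cst x) (fun t : R => t *: v)).
  exact: differentiable_cst.
by apply: (@differentiableZl _ _ _ id).
Qed.

Lemma differentiable_root_curve x v k s : increasing (roots_of (x + s *: v)) ->
  differentiable (root_curve x v k) s.
Proof.
move=> gs; apply: (@differentiable_comp _ _ _ _ (fun t : R => x + t *: v)
  (fun y : 'rV[R]_(n + n) => roots_of y 0 k)).
  exact: differentiable_line.
exact: differentiable_root.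
Qed.

Lemma derivable_root_curve x v k s : increasing (roots_of (x + s *: v)) ->
  derivable (root_curve x v k) s 1.
Proof. by move=> gs; apply/diff_derivable/differentiable_root_curve. Qed.

Lemma root_speedE x v k : increasing (roots_of x) ->
  root_speed x v k = ('d (@roots_of R n) x v : 'rV[R]_n) 0 k.
Proof.
move=> gx; have df := differentiable_roots_of gx.
rewrite -deriveE // derive_mx; last exact: diff_derivable.
rewrite mxE /root_speed /derive; set f := (X in lim (X @ _) = _); set g := (X in _ = lim (X @ _)).
suff -> : f = g by []; apply/funext => h; rewrite /f /g /=.
rewrite (_ : h%:A = h); last exact: mulr1.
by rewrite /root_curve scale0r !addr0 [x + _]addrC.
Qed.

Lemma derive_comb x v (c : 'I_n -> R) s : increasing (roots_of (x + s *: v)) ->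
  derivable (fun t => \sum_k c k * root_curve x v k t) s 1 /\
  'D_1 (fun t => \sum_k c k * root_curve x v k t) s = \sum_k c k * 'D_1 (root_curve x v k) s.
Proof.
move=> gs; have -> : (fun t => \sum_k c k * root_curve x v k t) =
    \sum_k (c k *: root_curve x v k) by apply/funext => t; rewrite fct_sumE.
have dk k : derivable (c k *: root_curve x v k) s 1.
  by apply: derivableZ; exact: derivable_root_curve.
split; first exact: derivable_sum.
rewrite derive_sum //; apply: eq_bigr => k _.
by rewrite deriveZ //; exact: derivable_root_curve.
Qed.

Lemma derivable_orbit x v (c : 'I_n -> R) (p : 'S_n) s : increasing (roots_of (x + s *: v)) ->
  derivable (fun t => \sum_k c k * root_curve x v (p k) t) s 1.
Proof.
move=> gs; have -> : (fun t => \sum_k c k * root_curve x v (p k) t) =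
    fun t => \sum_k c ((p^-1)%g k) * root_curve x v k t.
  apply/funext => t; rewrite (reindex_inj (@perm_inj _ (p^-1)%g)).
  by apply: eq_bigr => k _; rewrite permKV.
by case: (derive_comb (fun k => c ((p^-1)%g k)) gs).
Qed.

Lemma sum_root_speed x v : (0 < n)%N -> increasing (roots_of x) ->
  \sum_k root_speed x v k = \sum_k (lsubmx v : 'rV_n) 0 k + \sum_k (rsubmx v : 'rV_n) 0 k.
Proof.
move=> n0 gx; have [|_] := derive_comb (fun=> 1) (s := 0) (x := x) (v := v).
  by rewrite scale0r addr0.
under [X in _ = X]eq_bigr do rewrite mul1r.
move=> <-; set A := _ + _.
pose B := \sum_k (lsubmx x : 'rV_n) 0 k + \sum_k (rsubmx x : 'rV_n) 0 k.
have L (a b : 'rV[R]_n) t : \sum_k (a + t *: b) 0 k = \sum_k a 0 k + t * \sum_k b 0 k.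
  by rewrite mulr_sumr -big_split; apply: eq_bigr => k _; rewrite !mxE.
have -> : (fun t => \sum_k 1 * root_curve x v k t) = cst B + A *: id.
  apply/funext => t; transitivity (\sum_k roots_of (x + t *: v) 0 k).
    by apply: eq_bigr => k _; rewrite mul1r.
  rewrite sum_roots_of // !(linearD, linearZ) /= !L.
  by rewrite -[RHS]/(B + A * t) /A /B; ring.
by rewrite deriveD // deriveZ // derive_cst derive_id add0r -[_ *: _]/(_ * _) mulr1.
Qed.

(* Each factor [phi p] has a zero, and [phi 1] would have a second one, which
   exceeds the degree of their product. *)
Lemma root_speed_le0 x v (c : 'I_n -> R) : (forall s, increasing (roots_of (x + s *: v))) ->
  increasing (roots_of v) ->
  (forall p : 'S_n, \sum_k c k * roots_of v 0 (p k) < 0) ->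
  \sum_k c k * roots_of x 0 k = 0 -> \sum_k c k * root_speed x v k <= 0.
Proof.
move=> gs gv neg x0; rewrite leNgt; apply/negP => pos.
pose phi (p : 'S_n) s := \sum_k c k * root_curve x v (p k) s.
have phd p s : derivable (phi p) s 1 by exact: derivable_orbit.
have phc p : continuous (phi p).
  by move=> s; apply/differentiable_continuous/derivable1_diffP/phd.
have [eps e0 eneg] : exists2 e : R, 0 < e & forall t, `|t| <= e ->
    forall p : 'S_n, \sum_k c k * roots_of (v + t *: x) 0 (p k) < 0.
  have : \forall t \near (0 : R), forall p : 'S_n, \sum_k c k * roots_of (v + t *: x) 0 (p k) < 0.
    apply: (@filter_forall _ _ _ _ (nbhs_filter (0 : R))) => p.
    pose f t := \sum_k c k * root_curve v x (p k) t.
    have : f t @[t --> (0 : R)] --> f 0.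
      apply/differentiable_continuous/derivable1_diffP/derivable_orbit.
      by rewrite scale0r addr0.
    move/cvgr_lt; apply; rewrite /f /root_curve scale0r addr0; exact: neg.
  move/nbhs_ballP => [e /= e0 eP]; exists (e / 2); first by rewrite divr_gt0.
  by move=> t te; apply: eP; rewrite -ball_normE /= sub0r normrN; lra.
pose S := eps^-1; have S0 : 0 < S by rewrite invr_gt0.
have phS p : phi p S < 0.
  have -> : phi p S = S * \sum_k c k * roots_of (v + eps *: x) 0 (p k).
    rewrite mulr_sumr; apply: eq_bigr => k _; rewrite /root_curve.
    have -> : x + S *: v = S *: (v + eps *: x).
      by rewrite scalerDr scalerA mulVf ?gt_eqF // scale1r addrC.
    by rewrite roots_of_scale ?ltW // mxE mulrCA.
  by rewrite pmulr_rlt0 //; apply: eneg; rewrite gtr0_norm.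
(* Negating the pair reverses its ordered roots; the reversal is absorbed into the permutation, over
   which [eneg] is uniform. *)
have phNS p : 0 < phi p (- S).
  have -> : phi p (- S) = - (S * \sum_k c k *
      roots_of (v + (- eps) *: x) 0 ((p * perm rev_ord_inj)%g k)).
    rewrite mulr_sumr -sumrN; apply: eq_bigr => k _; rewrite /root_curve.
    have -> : x + - S *: v = S *: - (v + - eps *: x).
      by rewrite scalerN scalerDr scalerA mulrN mulVf ?gt_eqF // scaleN1r scaleNr opprB.
    by rewrite roots_of_scale ?ltW // mxE roots_of_opp permM permE; ring.
  by rewrite oppr_gt0 pmulr_rlt0 //; apply: eneg; rewrite normrN gtr0_norm.
have ivt p (a b : R) : a <= b -> phi p b < 0 -> 0 < phi p a -> exists2 z, a <= z & phi p z = 0.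
  move=> ab hb ha; have [||z] := @IVT R (phi p) a b 0 ab.
  - by apply: continuous_subspaceT; exact: phc.
  - by rewrite ge_min le_max (ltW ha) (ltW hb) orbT.
  by rewrite in_itv /= => /andP[az _] pz; exists z.
have ph1 : phi 1%g 0 = 0.
  by rewrite /phi -[RHS]x0; apply: eq_bigr => k _; rewrite perm1 /root_curve scale0r addr0.
(* A positive derivative at the zero 0 makes [phi 1] positive shortly after it; being negative at
   [S], it must vanish again beyond [s1]. *)
have [s1 /andP[s10 s1S] ps1] : exists2 s1, 0 < s1 < S & 0 < phi 1%g s1.
  have dpos : 0 < 'D_1 (phi 1%g) 0.
    have [_] := derive_comb c (gs 0).
    have -> : (fun t => \sum_k c k * root_curve x v k t) = phi 1%g.
      by apply/funext => t; apply: eq_bigr => k _; rewrite perm1.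
    by move=> ->.
  have := phd 1%g 0; rewrite /derivable => /cvgr_gt /(_ _ dpos).
  rewrite near_withinE => /nbhs_ballP [d /= d0 dP].
  pose h := Num.min (d / 2) (S / 2).
  have h0 : 0 < h by rewrite lt_min !divr_gt0.
  have [hd hS] : h <= d / 2 /\ h <= S / 2 by rewrite /h !ge_min !lexx orbT.
  exists h; first by rewrite h0; lra.
  have := dP h; rewrite -ball_normE /= sub0r normrN gtr0_norm // gt_eqF // => /(_ _ isT).
  rewrite scaler1 addr0 ph1 subr0 -[_ *: _]/(_ * _) pmulr_rgt0 ?invr_gt0 //.
  by apply; lra.
have [z' s1z pz'] := ivt 1%g s1 S (ltW s1S) (phS _) ps1.
(* The zero assigned to the identity is pinned at 0, so that [z'] counts as a second one. *)
have /choice [z zP] : forall p : 'S_n, exists z, phi p z = 0 /\ (p = 1%g -> z = 0).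
  move=> p; have [->|p1] := eqVneq p 1%g; first by exists 0.
  have [z _ pz] := ivt p (- S) S (ltac:(lra)) (phS p) (phNS p).
  by exists z; split=> // pE; rewrite pE eqxx in p1.
have [E [EP sE]] := convp_line x v.
have [D sD DP] := SymmetricOrbit.orbit_prod_poly c
  (g := fun s k => roots_of (x + s *: v) 0 k) (E := E)
  (fun s j jn => etrans (congr1 (fun q : {poly R} => q`_(n - j)) (esym (convp_roots _)))
     (EP s j jn)) sE.
have D0 : D = 0.
  apply: (@zeros_bound _ 'S_n phi z D 1%g z') => //.
  - by move=> p; case: (zP p).
  - by rewrite -[#|_|]/(#|{:'S_n}|) card_Sn.
  have [_ /(_ erefl) ->] := zP 1%g.
  by rewrite gt_eqF // (lt_le_trans s10).
have := DP S; rewrite D0 horner0 => /esym/eqP.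
by rewrite prodf_seq_eq0 => /hasP[p _ /=]; rewrite lt_eqF //; exact: phS.
Qed.
End Speed.

(** * Majorization and contraction *)

Section Majorization.
Variables (R : realType) (n : nat).
Hypothesis n_gt0 : (0 < n)%N.
Implicit Types x v z : 'rV[R]_(n + n).
Local Notation ones := (const_mx 1 : 'rV[R]_n).

Definition centered_pair v :=
  \sum_k (lsubmx v : 'rV[R]_n) 0 k = 0 /\ \sum_k (rsubmx v : 'rV[R]_n) 0 k = 0.

Lemma root_speed_shift x v b t k : increasing (roots_of x) ->
  root_speed (x + row_mx (b *: ones) (0 *: ones)) (v + row_mx (t *: ones) (0 *: ones)) k =
  root_speed x v k + t.
Proof.
move=> gx; rewrite /root_speed.
have -> : root_curve (x + row_mx (b *: ones) (0 *: ones)) (v + row_mx (t *: ones) (0 *: ones)) k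
   = root_curve x v k + (cst b + t *: id).
  apply/funext => s; rewrite /root_curve.
  have -> : x + row_mx (b *: ones) (0 *: ones) + s *: (v + row_mx (t *: ones) (0 *: ones)) =
      (x + s *: v) + row_mx ((b + s * t) *: ones) (0 *: ones).
    by rewrite scalerDr scale_row_mx !scalerA mulr0 addrACA add_row_mx -!scalerDl addr0.
  by rewrite roots_of_shift !mxE mulr1 addr0 -[RHS]/(_ + (b + t * s)) [s * t]mulrC.
have d0 : derivable (root_curve x v k) 0 1.
  by apply: derivable_root_curve; rewrite scale0r addr0.
have dl : derivable (cst b + t *: id : R -> R) 0 1.
  by apply: derivableD => //; apply: derivableZ.
rewrite deriveD // deriveD // deriveZ // derive_cst derive_id add0r.
by rewrite -[_ *: _]/(_ * _) mulr1.
Qed.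

(** Otherwise some [t] lies above every $\langle w,\kappa\circ p\rangle$ and below $|w|^2$. Shifting
    the line in position and in direction by multiples of the all-ones vector makes the weighted sum
    vanish at time 0 and all asymptotic slopes negative; [root_speed_le0] then yields $|w|^2\le
    t$. *)
Lemma majorization x v : centered_pair v ->
  (forall s, increasing (roots_of (x + s *: v))) -> increasing (roots_of v) ->
  exists p : 'S_n, \sum_k root_speed x v k ^+ 2 <= \sum_k root_speed x v k * roots_of v 0 (p k).
Proof.
move=> [l0 r0] gs gv; apply: contrapT => /forallNP H.
set w := root_speed x v in H *.
have gx : increasing (roots_of x) by have := gs 0; rewrite scale0r addr0.
have n0 : n%:R != 0 :> R by rewrite pnatr_eq0 -lt0n.
have w0 : \sum_k w k = 0 by rewrite sum_root_speed // l0 r0 addr0.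
have k0 : \sum_k roots_of v 0 k = 0 by rewrite sum_roots_of // l0 r0 addr0.
have {}H (p : 'S_n) : \sum_k w k * roots_of v 0 (p k) < \sum_k w k ^+ 2.
  by rewrite ltNge; apply/negP; exact: H.
have [t tH tw] : exists2 t, (forall p : 'S_n, \sum_k w k * roots_of v 0 (p k) < t) &
    t < \sum_k w k ^+ 2.
  set T := \sum_k w k ^+ 2 in H *.
  have near1 : \forall t \near T^'-, forall p : 'S_n, \sum_k w k * roots_of v 0 (p k) < t.
    by apply: filter_forall => p; exact: nbhs_left_gt.
  have near2 : \forall t \near T^'-, t < T by exact: nbhs_left_lt.
  by have [t []] := filter_ex (filterI near1 near2); exists t.
(* Weights of total mass 1, so that shifting all roots shifts their weighted sum. *)
pose c k := w k + n%:R^-1.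
have c1 : \sum_k c k = 1.
  by rewrite big_split /= w0 add0r sumr_const card_ord -(mulr_natr n%:R^-1 n) mulVf.
have cE (f : 'I_n -> R) : \sum_k f k = 0 -> \sum_k c k * f k = \sum_k w k * f k.
  move=> f0; under eq_bigr do rewrite mulrDl.
  by rewrite big_split /= -mulr_sumr f0 mulr0 addr0.
pose b := \sum_k c k * roots_of x 0 k.
have cshift (f : 'I_n -> R) e : \sum_k c k * (f k + e) = \sum_k c k * f k + e.
  under eq_bigr do rewrite mulrDr.
  by rewrite big_split /= -mulr_suml c1 mul1r.
pose sh e : 'rV[R]_(n + n) := row_mx (e *: ones) (0 *: ones).
have shE y e k : roots_of (y + sh e) 0 k = roots_of y 0 k + e.
  by rewrite roots_of_shift !mxE mulr1 addr0.
have incr_sh y e : increasing (roots_of y) -> increasing (roots_of (y + sh e)).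
  by move=> gy i j ij; rewrite (shE y e i) (shE y e j) ltrD2r gy.
have lineE s : x + sh (- b) + s *: (v + sh (- t)) = (x + s *: v) + sh (- b + s * - t).
  by rewrite scalerDr scale_row_mx !scalerA mulr0 addrACA add_row_mx -!scalerDl addr0.
have le0 : \sum_k c k * root_speed (x + sh (- b)) (v + sh (- t)) k <= 0.
  apply: root_speed_le0.
  - by move=> s; rewrite lineE; apply: incr_sh.
  - exact: incr_sh.
  - move=> p; under eq_bigr do rewrite (shE v (- t)).
    rewrite cshift subr_lt0 cE //.
    by rewrite -[RHS]k0 [RHS](reindex_inj (@perm_inj _ p)).
  - by under eq_bigr do rewrite (shE x (- b)); rewrite cshift subrr.
move: le0; apply/negP; rewrite -ltNge; under eq_bigr do rewrite root_speed_shift //.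
rewrite cshift subr_gt0 cE //.
Qed.

(* No point of the projective line through x and v, v included, has coinciding
   entries on both sides. *)
Definition transverse x v := forall i j k l : 'I_n, i != j -> k != l ->
  ((lsubmx v : 'rV_n) 0 i - (lsubmx v : 'rV_n) 0 j) *
    ((rsubmx x : 'rV_n) 0 k - (rsubmx x : 'rV_n) 0 l) !=
  ((lsubmx x : 'rV_n) 0 i - (lsubmx x : 'rV_n) 0 j) *
    ((rsubmx v : 'rV_n) 0 k - (rsubmx v : 'rV_n) 0 l).

Lemma not_injectiveP (f : 'I_n -> R) : ~ injective f -> exists i j, i != j /\ f i = f j.
Proof.
move=> fN; apply: contrapT => H; apply: fN => i j fij; apply/eqP; apply: contraT => ij.
by case: H; exists i, j.
Qed.

(** Coincidences on both sides at time [s] give $x_i-x_j=-s(v_i-v_j)$ and its analogue for $k,l$;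
    cross-multiplying produces the equality that transversality forbids. The point [v] itself would
    make both products zero. *)
Lemma transverse_one_simple x v : transverse x v -> one_simple v /\ forall s, one_simple (x + s *: v).
Proof.
have gP (y : 'rV[R]_(n + n)) : (forall i j k l : 'I_n, i != j -> k != l ->
    (lsubmx y : 'rV_n) 0 i = (lsubmx y : 'rV_n) 0 j ->
    (rsubmx y : 'rV_n) 0 k = (rsubmx y : 'rV_n) 0 l -> False) -> one_simple y.
  move=> H; apply: contrapT => /not_orP[N1 N2].
  have [i [j [ij E1]]] := not_injectiveP N1; have [k [l [kl E2]]] := not_injectiveP N2.
  exact: (H i j k l).
move=> tr; split=> [|s]; apply: gP => i j k l ij kl.
  by move=> E1 E2; have /eqP := tr i j k l ij kl; apply; rewrite E1 E2 !subrr mul0r mulr0.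
rewrite !linearD !linearZ /= => E1 E2; have /eqP := tr i j k l ij kl; apply.
move: E1 E2; rewrite !mxE => E1 E2.
set a := x _ _ in E1 *; set a' := x _ _ in E1 *; set u := v _ _ in E1 *; set u' := v _ _ in E1 *.
set b := x _ _ in E2 *; set b' := x _ _ in E2 *; set y := v _ _ in E2 *; set y' := v _ _ in E2 *.
have -> : a - a' = s * (u' - u) by rewrite mulrBr; lra.
have -> : b - b' = s * (y' - y) by rewrite mulrBr; lra.
by ring.
Qed.

End Majorization.

Section Dot.
Variable R : realType.

Lemma dot_line m (a b : 'rV[R]_m) t :
  dot (a + t *: b) (a + t *: b) = dot a a + 2 * t * dot a b + t ^+ 2 * dot b b.
Proof.
rewrite /dot !mulr_sumr -!big_split /=; apply: eq_bigr => i _; rewrite !mxE; ring.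
Qed.

Lemma dot_lineE m (a b : 'rV[R]_m) :
  (fun t => dot (a + t *: b) (a + t *: b)) =
  horner ((dot a a)%:P + (2 * dot a b) *: 'X + dot b b *: 'X^2).
Proof. by apply/funext => t; rewrite dot_line !hornerE /=; ring. Qed.

Lemma dot_sqr m (a : 'rV[R]_m) : dot a a = \sum_k a 0 k ^+ 2.
Proof. by apply: eq_bigr => k _; rewrite expr2. Qed.

Lemma dnbhs0_neq (t0 : R) : \forall t \near (0 : R)^', t != t0.
Proof.
have [->|t00] := eqVneq t0 0; first exact: nbhs_dnbhs_neq.
apply: nbhs_dnbhs; apply: open_nbhs_nbhs; split; first exact: open_neq.
by rewrite /= eq_sym.
Qed.

End Dot.

(** * Contraction on centered pairs and its equality case *)

Section Contraction.
Variables (R : realType) (n : nat) (x : 'rV[R]_(n + n)).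
Hypothesis n_gt1 : (1 < n)%N.
Local Notation alpha := (lsubmx x : 'rV[R]_n).
Local Notation beta := (rsubmx x : 'rV[R]_n).
Hypothesis alphaI : injective (alpha 0).
Hypothesis betaI : injective (beta 0).
Implicit Types v : 'rV[R]_(n + n).

Let n_gt0 : (0 < n)%N. Proof. exact: ltnW. Qed.

Lemma increasing_base : increasing (roots_of x).
Proof. by apply: one_simple_increasing; left. Qed.

Definition tangent v : 'rV[R]_n := 'd (@roots_of R n) x v.

Lemma tangentE v k : tangent v 0 k = root_speed x v k.
Proof. by rewrite /tangent root_speedE //; exact: increasing_base. Qed.

(* Adding a small multiple of this direction makes any line through x transverse. *)
Definition mirror : 'rV[R]_(n + n) := row_mx (centered alpha) (- centered beta).

Lemma sum_centered (a : 'rV[R]_n) : \sum_k centered a 0 k = 0.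
Proof.
rewrite /centered; under eq_bigr do rewrite !mxE mulr1.
rewrite big_split /= sumr_const card_ord mulNrn -[_ *+ n]mulr_natr divfK ?subrr //.
by rewrite pnatr_eq0 -lt0n.
Qed.

Lemma centered_mirror : centered_pair mirror.
Proof.
rewrite /centered_pair row_mxKl row_mxKr; split; first exact: sum_centered.
under eq_bigr do rewrite mxE.
by rewrite sumrN sum_centered oppr0.
Qed.

Lemma centered_pair_line v z t : centered_pair v -> centered_pair z -> centered_pair (v + t *: z).
Proof.
move=> [l1 r1] [l2 r2]; rewrite /centered_pair !linearD !linearZ /=.
have L (a b : 'rV[R]_n) : \sum_k (a + t *: b) 0 k = \sum_k a 0 k + t * \sum_k b 0 k.
  by rewrite mulr_sumr -big_split; apply: eq_bigr => k _; rewrite !mxE.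
by rewrite !L l1 l2 r1 r2 mulr0 addr0.
Qed.

(** Since [mirror] moves the two halves with opposite signs, each condition is affine in [t] with
    slope [2 * p * q], nonzero as both halves of [x] have distinct entries. Each of the finitely
    many conditions thus excludes a single [t]. *)
Lemma transverse_near v : \forall t \near (0 : R)^', transverse x (v + t *: mirror).
Proof.
have H : \forall t \near (0 : R)^', forall q : ('I_n * 'I_n) * ('I_n * 'I_n),
    let: (i, j, (k, l)) := q in i != j -> k != l ->
    ((lsubmx (v + t *: mirror) : 'rV_n) 0 i - (lsubmx (v + t *: mirror) : 'rV_n) 0 j) *
      (beta 0 k - beta 0 l) !=
    (alpha 0 i - alpha 0 j) *
      ((rsubmx (v + t *: mirror) : 'rV_n) 0 k - (rsubmx (v + t *: mirror) : 'rV_n) 0 l).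
  apply: filter_forall => -[[i j] [k l]].
  have [->|ij] := eqVneq i j; first by apply: nearW.
  have [->|kl] := eqVneq k l; first by apply: nearW.
  set p := alpha 0 i - alpha 0 j; set q := beta 0 k - beta 0 l.
  have p0 : p != 0 by rewrite subr_eq0; apply: contra_neq ij; exact: alphaI.
  have q0 : q != 0 by rewrite subr_eq0; apply: contra_neq kl; exact: betaI.
  set u := (lsubmx v : 'rV_n) 0 i - (lsubmx v : 'rV_n) 0 j.
  set y := (rsubmx v : 'rV_n) 0 k - (rsubmx v : 'rV_n) 0 l.
  apply: filterS (dnbhs0_neq (- (u * q - p * y) / (2 * p * q))) => t tN _ _.
  rewrite !linearD !linearZ /= row_mxKl row_mxKr.
  apply: contra_neq tN => E; apply: (canRL (mulfK _)); first by rewrite !mulf_neq0.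
  have e1 : (lsubmx v + t *: centered alpha) 0 i - (lsubmx v + t *: centered alpha) 0 j = u + t * p.
    by rewrite /u /p !mxE; ring.
  have e2 : (rsubmx v + t *: - centered beta) 0 k -
      (rsubmx v + t *: - centered beta) 0 l = y - t * q.
    by rewrite /y /q !mxE; ring.
  by move: E; rewrite e1 e2 => E; lra.
by apply: filterS H => t Ht i j k l; exact: (Ht (i, j, (k, l))).
Qed.

Lemma tangent_line v z t : tangent (v + t *: z) = tangent v + t *: tangent z.
Proof. by rewrite /tangent linearD linearZ. Qed.

(** Expand $0\le|w-\kappa\circ p|^2$ with the permutation from [majorization]: this gives
    $|w|^2\le|\kappa|^2$, and $|\kappa|=|v|$ by additivity of the variance. *)
Lemma tangent_le_transverse v : centered_pair v -> transverse x v ->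
  dot (tangent v) (tangent v) <= dot v v.
Proof.
move=> vc tr; have [gv gl] := transverse_one_simple tr.
have iv := one_simple_increasing gv.
have [p pP] := majorization n_gt0 vc (fun s => one_simple_increasing (gl s)) iv.
case: (vc) => l0 r0; rewrite -(sqr_roots_of n_gt1 l0 r0).
have E1 : dot (tangent v) (tangent v) = \sum_k root_speed x v k ^+ 2.
  by rewrite dot_sqr; apply: eq_bigr => k _; rewrite tangentE.
have E2 : dot (roots_of v) (roots_of v) = \sum_k roots_of v 0 (p k) ^+ 2.
  by rewrite dot_sqr (reindex_inj (@perm_inj _ p)).
have : 0 <= \sum_k (root_speed x v k - roots_of v 0 (p k)) ^+ 2.
  by apply: sumr_ge0 => k _; rewrite sqr_ge0.
have -> : \sum_k (root_speed x v k - roots_of v 0 (p k)) ^+ 2 =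
   \sum_k root_speed x v k ^+ 2 - 2 * \sum_k root_speed x v k * roots_of v 0 (p k)
   + \sum_k roots_of v 0 (p k) ^+ 2.
  by rewrite mulr_sumr -sumrB -big_split; apply: eq_bigr => k _ /=; ring.
by rewrite E1 E2; lra.
Qed.

Lemma tangent_le v : centered_pair v -> dot (tangent v) (tangent v) <= dot v v.
Proof.
move=> vc.
pose f t := dot (tangent v + t *: tangent mirror) (tangent v + t *: tangent mirror).
pose g t := dot (v + t *: mirror) (v + t *: mirror).
have fc : f @ (0 : R)^' --> f 0.
  by apply/continuous_withinNx; rewrite /f dot_lineE; exact: continuous_horner.
have gc : g @ (0 : R)^' --> g 0.
  by apply/continuous_withinNx; rewrite /g dot_lineE; exact: continuous_horner.
have f0 : f 0 = dot (tangent v) (tangent v) by rewrite /f scale0r addr0.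
have g0 : g 0 = dot v v by rewrite /g scale0r addr0.
rewrite -f0 -g0; apply: ler_cvg_to fc gc _.
apply: filterS (transverse_near v) => t tr; rewrite /f /g -tangent_line.
by apply: tangent_le_transverse => //; apply: centered_pair_line => //; exact: centered_mirror.
Qed.

(** The permutation supplied by [majorization] may vary with [t], so the limit is taken by
    contradiction: finitely many strict reverse inequalities would persist for small [t], including
    transverse ones. Simple roots at [v] make the root curves through [v] continuous. *)
Lemma majorization_tangent v : centered_pair v -> increasing (roots_of v) ->
  exists p : 'S_n, dot (tangent v) (tangent v) <= \sum_k tangent v 0 k * roots_of v 0 (p k).
Proof.
move=> vc iv; apply: contrapT => /forallNP H.
pose F (p : 'S_n) t := dot (tangent v + t *: tangent mirror) (tangent v + t *: tangent mirror)
  - \sum_k (tangent v 0 k + t * tangent mirror 0 k) * root_curve v mirror (p k) t.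
have cv k : {for (0 : R), continuous (root_curve v mirror k)}.
  by apply/differentiable_continuous/differentiable_root_curve; rewrite scale0r addr0.
have Fc p : {for (0 : R), continuous (F p)}.
  apply: continuousB; first by rewrite dot_lineE; exact: continuous_horner.
  have sc (l : seq 'I_n) : {for (0 : R), continuous (fun t : R => \sum_(k <- l)
      (tangent v 0 k + t * tangent mirror 0 k) * root_curve v mirror (p k) t)}.
    elim: l => [|k l IH].
      rewrite (_ : (fun t => _) = cst 0); first exact: cst_continuous.
      by apply/funext => t; rewrite big_nil.
    rewrite (_ : (fun t => _) = (fun t : R =>
      (tangent v 0 k + t * tangent mirror 0 k) * root_curve v mirror (p k) t
      + \sum_(k <- l) (tangent v 0 k + t * tangent mirror 0 k) * root_curve v mirror (p k) t)).
      apply: continuousD => //; apply: continuousM => //.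
      apply: continuousD; first exact: cst_continuous.
      by apply: continuousM; [exact: cvg_id|exact: cst_continuous].
    by apply/funext => t; rewrite big_cons.
  exact: sc.
have pos : \forall t \near (0 : R), forall p, 0 < F p t.
  apply: (@filter_forall _ _ _ _ (nbhs_filter (0 : R))) => p.
  have : F p t @[t --> (0 : R)] --> F p 0 by exact: Fc.
  move/cvgr_gt; apply; rewrite /F scale0r addr0 subr_gt0.
  rewrite ltNge; apply/negP => le; apply: (H p); apply: le_trans le _.
  rewrite (_ : \sum_k _ = \sum_k tangent v 0 k * roots_of v 0 (p k)) //.
  by apply: eq_bigr => k _; rewrite mul0r addr0 /root_curve scale0r addr0.
have [t [tr tp]] := filter_ex (filterI (transverse_near v) (nbhs_dnbhs pos)).
have [gv gl] := transverse_one_simple tr.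
have [p pP] := majorization n_gt0 (centered_pair_line t vc centered_mirror)
  (fun s => one_simple_increasing (gl s)) (one_simple_increasing gv).
have := tp p; rewrite /F ltNge subr_le0 => /negP; apply.
rewrite -tangent_line dot_sqr; move: pP.
under eq_bigr do rewrite -tangentE; under [X in _ <= X -> _]eq_bigr do rewrite -tangentE.
rewrite (_ : \sum_k (tangent v 0 k + _) * _ =
  \sum_k tangent (v + t *: mirror) 0 k * roots_of (v + t *: mirror) 0 (p k)) //.
by apply: eq_bigr => k _; rewrite tangent_line !mxE.
Qed.

(** The equality case: the same square is now at most 0, so [tangent v] is a permutation of the
    distinct roots of [v]. *)
Lemma tangent_isometric v : centered_pair v -> increasing (roots_of v) ->
  dot (tangent v) (tangent v) = dot v v -> injective (tangent v 0).
Proof.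
move=> vc iv vE; have [p pP] := majorization_tangent vc iv.
case: (vc) => l0 r0.
have E2 : dot v v = \sum_k roots_of v 0 (p k) ^+ 2.
  by rewrite -(sqr_roots_of n_gt1 l0 r0) dot_sqr (reindex_inj (@perm_inj _ p)).
have S0 : \sum_k (tangent v 0 k - roots_of v 0 (p k)) ^+ 2 <= 0.
  have -> : \sum_k (tangent v 0 k - roots_of v 0 (p k)) ^+ 2 =
     dot (tangent v) (tangent v) - 2 * \sum_k tangent v 0 k * roots_of v 0 (p k)
     + \sum_k roots_of v 0 (p k) ^+ 2.
    by rewrite dot_sqr mulr_sumr -sumrB -big_split; apply: eq_bigr => k _ /=; ring.
  by rewrite -E2 -vE; lra.
have eqk k : tangent v 0 k = roots_of v 0 (p k).
  have S1 : \sum_k (tangent v 0 k - roots_of v 0 (p k)) ^+ 2 == 0.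
    by rewrite eq_le S0 /= sumr_ge0 // => i _; rewrite sqr_ge0.
  move: S1; rewrite psumr_eq0 => [/allP/(_ k)|i _]; last exact: sqr_ge0.
  by rewrite mem_index_enum sqrf_eq0 subr_eq0 => /(_ isT)/eqP.
by move=> i j; rewrite !eqk => /(increasing_inj iv)/perm_inj.
Qed.

End Contraction.

(** * Residues and strict monotonicity *)

Section Wronskian.
Variable R : realType.
Implicit Types p q r f : {poly R}.

Lemma coefM_top p q a b : (size p <= a.+1)%N -> (size q <= b.+1)%N ->
  (p * q)`_(a + b) = p`_a * q`_b.
Proof.
move=> sp sq; rewrite coefM; have aab : (a < (a + b).+1)%N by rewrite ltnS leq_addr.
rewrite (bigD1 (Ordinal aab)) //= addKn big1 ?addr0 // => -[i /= iab] ia.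
have [ai|ia'|iE] := ltngtP a i.
- by rewrite [p`_i]nth_default ?mul0r // (leq_trans sp).
- by rewrite [q`__]nth_default ?mulr0 // (leq_trans sq) //; lia.
by case/negP: ia; apply/eqP/val_inj.
Qed.

Definition wronskian r f := r^`() * f - r * f^`().

Lemma poly_gt0_no_root p : (forall y, p.[y] != 0) -> 0 < lead_coef p -> forall y, 0 < p.[y].
Proof.
move=> p0 lp y; rewrite lt_neqAle eq_sym p0 leNgt /=; apply/negP => py.
have [m mP] := poly_pinfty_gt_lc lp.
pose M := Num.max m y.
have pM : 0 < p.[M] by apply: lt_le_trans lp _; apply: mP; rewrite le_max lexx.
have [||z _ /eqP] := @poly_ivtoo R p y M; first by rewrite le_max lexx orbT.
  by rewrite nmulr_rlt0.
by apply/eqP/p0.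
Qed.

(** A zero [y] of the Wronskian yields a multiple root at [y]: of [r - t *: f] with $t=r(y)/f(y)$,
    or with $t=r'(y)/f'(y)$ when $f(y)=0$. Hence there is no zero, and the leading coefficient
    decides the sign. *)
Lemma wronskian_gt0 r f m : r \is monic -> f \is monic -> size r = m.+2 -> size f = m.+1 ->
  (forall y, f.[y] = 0 -> f^`().[y] != 0) ->
  (forall t y, (r - t *: f).[y] = 0 -> (r - t *: f)^`().[y] != 0) ->
  forall y, 0 < (wronskian r f).[y].
Proof.
move=> rm fm sr sf fs rfs.
have rfE t y : (r - t *: f).[y] = r.[y] - t * f.[y] by rewrite !hornerE.
have drfE t y : (r - t *: f)^`().[y] = r^`().[y] - t * f^`().[y].
  by rewrite derivB derivZ !hornerE.
have wE y : (wronskian r f).[y] = r^`().[y] * f.[y] - r.[y] * f^`().[y].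
  by rewrite /wronskian !hornerE.
apply: poly_gt0_no_root => [y|].
  apply/eqP => w0; rewrite wE in w0.
  have [fy|fy] := eqVneq f.[y] 0.
    have dfy := fs _ fy; rewrite fy mulr0 sub0r in w0.
    have ry : r.[y] = 0.
      by move/eqP: w0; rewrite oppr_eq0 mulf_eq0 (negPf dfy) orbF => /eqP.
    have := rfs (r^`().[y] / f^`().[y]) y; rewrite rfE drfE ry fy mulr0 subrr.
    by rewrite divfK // subrr eqxx => /(_ erefl).
  have := rfs (r.[y] / f.[y]) y; rewrite rfE drfE divfK // subrr => /(_ erefl).
  apply/negP; rewrite negbK subr_eq0 mulrAC; apply/eqP/(canRL (mulfK fy)).
  by apply/eqP; rewrite -subr_eq0 w0.
have sdr : (size r^`() <= m.+1)%N.
  by apply/leq_sizeP => k mk; rewrite coef_deriv nth_default ?mul0rn // sr.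
have sdf : (size f^`() <= m)%N.
  by apply/leq_sizeP => k mk; rewrite coef_deriv nth_default ?mul0rn // sf.
have rl : r`_m.+1 = 1 by have := monicP rm; rewrite lead_coefE sr.
have fl : f`_m = 1 by have := monicP fm; rewrite lead_coefE sf.
(* The leading terms of the two products contribute [m.+1] and [m], whose difference is 1. *)
have top : (wronskian r f)`_(m + m) = 1.
  rewrite coefB (coefM_top sdr) ?sf // coef_deriv rl fl mulr1.
  case: m sr sf sdr sdf rl fl => [|m] sr sf sdr sdf rl fl.
    by move: sdf; rewrite leqn0 size_poly_eq0 => /eqP ->; rewrite mulr0 coef0 subr0.
  have -> : (m.+1 + m.+1 = m.+2 + m)%N by lia.
  by rewrite (coefM_top _ sdf) ?sr // coef_deriv rl fl mul1r -mulrnBr // subSnn.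
have sW : size (wronskian r f) = (m + m).+1.
  apply/eqP; rewrite eqn_leq; apply/andP; split; last first.
    by rewrite ltnNge; apply/negP => /leq_sizeP/(_ _ (leqnn _)) /eqP; rewrite top oner_eq0.
  rewrite (leq_trans (size_polyD _ _)) // size_polyN geq_max.
  move: sdr sdf; set a := size r^`(); set b := size f^`() => ha hb.
  apply/andP; split; apply: leq_trans (size_polyMleq _ _) _; rewrite ?sr ?sf -/a -/b; lia.
by rewrite lead_coefE sW /= top ltr01.
Qed.

Lemma deriv_rpoly n (w : 'rV[R]_n) k :
  (rpoly w)^`().[w 0 k] = \prod_(l < n | l != k) (w 0 k - w 0 l).
Proof.
rewrite /rpoly (bigD1 k) //= deriv_XsubCM !hornerE subrr mul0r addr0 horner_prod.
by apply: eq_bigr => l _; rewrite hornerXsubC.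
Qed.

Lemma deriv_rpoly_neq0 n (w : 'rV[R]_n) k : injective (w 0) -> (rpoly w)^`().[w 0 k] != 0.
Proof.
move=> wI; rewrite deriv_rpoly; apply/prodf_neq0 => l lk; rewrite subr_eq0.
by apply: contra_neq lk => /wI.
Qed.

(** Lagrange interpolation at the entries of [w]: the difference [q] has degree below [n] and [n]
    distinct roots. *)
Lemma partial_fractions n (w : 'rV[R]_n) (h : {poly R}) y : injective (w 0) ->
  (size h <= n)%N -> (forall k, y != w 0 k) ->
  h.[y] = (rpoly w).[y] * \sum_k (h.[w 0 k] / (rpoly w)^`().[w 0 k]) / (y - w 0 k).
Proof.
move=> wI sh yw.
pose L k := \prod_(l < n | l != k) ('X - (w 0 l)%:P).
have LE k z : (L k).[z] = \prod_(l < n | l != k) (z - w 0 l).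
  by rewrite horner_prod; apply: eq_bigr => l _; rewrite hornerXsubC.
have sL k : (size (L k) <= n)%N.
  have := size_rpoly w; rewrite /rpoly (bigD1 k) //= size_Mmonic.
  - by rewrite size_XsubC add2n /= => -[->].
  - by rewrite polyXsubC_eq0.
  by apply: monic_prod => l _; exact: monicXsubC.
pose q := h - \sum_k (h.[w 0 k] / (rpoly w)^`().[w 0 k]) *: L k.
have q0 : q = 0.
  apply: (@roots_geq_poly_eq0 R q (entries w)).
  - apply/allP => z /mapP[k _ ->]; rewrite /root /q hornerD hornerN horner_sum.
    rewrite (bigD1 k) //= big1 ?addr0 => [|l lk].
      by rewrite hornerZ LE -deriv_rpoly divfK ?subrr // deriv_rpoly_neq0.
    by rewrite hornerZ LE (bigD1 k) 1?eq_sym //= subrr mul0r mulr0.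
  - by rewrite map_inj_uniq ?enum_uniq //; exact: wI.
  rewrite size_entries /q (leq_trans (size_polyD _ _)) // geq_max sh size_polyN.
  apply: (leq_trans (size_sum _ _ _)); apply/bigmax_leqP => k _.
  exact: leq_trans (size_scale_leq _ _) (sL k).
move/eqP: q0; rewrite subr_eq0 => /eqP {1}->; rewrite horner_sum mulr_sumr.
apply: eq_bigr => k _; rewrite hornerZ LE horner_rpoly [X in _ = X * _](bigD1 k) //=.
by field; rewrite subr_eq0 yw deriv_rpoly_neq0.
Qed.
End Wronskian.

Section Monotone.
Variables (R : realType) (n : nat).

(** Let [k0] be the last index with [gam k0 < xi]; it exists since otherwise the vanishing sum would
    be positive. That sum allows [w k] to be replaced by [w k - w k0], after which both factors of
    each term change sign together, and equality forces [w] to be constant. *)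
Lemma weighted_sum_gt0 (gam A w : 'I_n -> R) xi : (0 < n)%N ->
  (forall i j : 'I_n, (i <= j)%N -> gam i <= gam j) ->
  (forall i j : 'I_n, (i <= j)%N -> w i <= w j) ->
  (forall k, 0 < A k) -> (forall k, gam k != xi) ->
  \sum_k A k / (gam k - xi) = 0 -> ~ (forall i j, w i = w j) ->
  0 < \sum_k w k * (A k / (gam k - xi)).
Proof.
move=> n0 gamS wS A0 gxi S0 wN.
have pos k : xi < gam k -> 0 < A k / (gam k - xi) by move=> ?; rewrite divr_gt0 // subr_gt0.
have neg k : gam k < xi -> A k / (gam k - xi) < 0.
  by move=> ?; rewrite ltr_ndivrMr ?mul0r // subr_lt0.
have [k1 k1xi] : exists k, gam k < xi.
  apply: contrapT => /forallNP H; move: S0; apply/eqP; rewrite gt_eqF //.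
  have all_pos k : 0 < A k / (gam k - xi).
    by apply: pos; rewrite lt_neqAle eq_sym gxi leNgt; apply/negP; exact: H.
  by rewrite (bigD1 (Ordinal n0)) //= ltr_wpDr // sumr_ge0 // => k _; exact/ltW.
case: (@arg_maxnP 'I_n k1 (fun k => gam k < xi) val k1xi) => k0 /= k0xi k0max.
have -> : \sum_k w k * (A k / (gam k - xi)) = \sum_k (w k - w k0) * (A k / (gam k - xi)).
  under [RHS]eq_bigr do rewrite mulrBl.
  by rewrite sumrB -mulr_sumr S0 mulr0 subr0.
have cmp k : gam k < xi /\ w k - w k0 <= 0 \/ xi < gam k /\ 0 <= w k - w k0.
  case: (ltgtP (gam k) xi) (gxi k) => // kxi _; [left|right]; split=> //.
    by rewrite subr_le0 wS //; exact: k0max.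
  rewrite subr_ge0 wS // leqNgt; apply/negP => kk0.
  have := gamS k k0 (ltnW kk0); rewrite leNgt => /negP; apply; exact: lt_trans k0xi kxi.
have term_ge0 k : 0 <= (w k - w k0) * (A k / (gam k - xi)).
  by have [[/neg h1 h2]|[/pos h1 h2]] := cmp k; [rewrite nmulr_lge0|rewrite pmulr_lge0].
rewrite lt_neqAle sumr_ge0 // andbT eq_sym; apply/negP => /eqP S1; apply: wN.
suff wE k : w k = w k0 by move=> i j; rewrite !wE.
have := S1 => /eqP; rewrite psumr_eq0 // => /allP/(_ k).
rewrite mem_index_enum => /(_ isT); rewrite mulf_eq0 subr_eq0 => /orP[/eqP //|].
by have [[/neg h1 _]|[/pos h1 _]] := cmp k; [rewrite lt_eqF|rewrite gt_eqF].
Qed.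
End Monotone.

(** * Residues of quotients of convolutions of successively shorter lists *)

Section Residues.
Variables (R : realType) (n : nat) (b : 'rV[R]_n).
Hypothesis bI : injective (b 0).
Implicit Types (l : seq R).

(** The operator keeps its degree parameter [n] while [l] may be shorter, so that removing roots
    from [l] stays linear; the degree of the result is [size l]. *)
Definition conv_list l : {poly R} := fconv n (\prod_(x <- l) ('X - x%:P)) (rpoly b).

Lemma realrooted_prod l : realrooted (\prod_(x <- l) ('X - x%:P)).
Proof. by exists l; rewrite (monicP (monic_prod_XsubC _ _ _)) scale1r. Qed.

Lemma conv_list_monic l : conv_list l \is monic /\ size (conv_list l) = (size l).+1.
Proof.
have [s lc] := lead_fconv (\prod_(x <- l) ('X - x%:P)) (monic_rpoly b) (size_rpoly b).
rewrite /conv_list s size_prod_XsubC; split=> //.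
by rewrite monicE lc (monicP (monic_prod_XsubC _ _ _)).
Qed.

Lemma conv_list_simple l y : (size l <= n)%N ->
  (conv_list l).[y] = 0 -> (conv_list l)^`().[y] != 0.
Proof.
move=> sl; apply: fconv_simple => //; first exact: realrooted_prod.
  exact: monic_neq0 (monic_prod_XsubC _ _ _).
by rewrite size_prod_XsubC.
Qed.

Lemma realrooted_conv_list l : (size l <= n)%N -> realrooted (conv_list l).
Proof.
move=> sl; rewrite /conv_list rpolyE; apply: realrooted_fconv.
- exact: size_entries.
- by rewrite size_prod_XsubC.
- exact: monic_neq0 (monic_prod_XsubC _ _ _).
exact: realrooted_prod.
Qed.

(** By linearity the combinations occurring in [wronskian_gt0] are again convolutions, with one root
    moved, and so have simple roots. *)
Lemma conv_list_shift l c t : conv_list (c :: l) - t *: conv_list l = conv_list (c + t :: l).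
Proof.
rewrite /conv_list !big_cons -scaleNr -fconvZl -fconvDl; congr fconv.
by rewrite -mul_polyC polyCD polyCN; ring.
Qed.

(** At a root of $r$ the Wronskian is $r'f$, which has the sign of the residue $f/r'$. *)
Lemma residue_gt0 l c y : (size l < n)%N -> (conv_list (c :: l)).[y] = 0 ->
  0 < (conv_list l).[y] / (conv_list (c :: l))^`().[y].
Proof.
move=> sl ry.
have [rm sr] := conv_list_monic (c :: l); have [fm sf] := conv_list_monic l.
have W : 0 < (wronskian (conv_list (c :: l)) (conv_list l)).[y].
  apply: (wronskian_gt0 rm fm sr sf) => [z|t z]; first exact/conv_list_simple/ltnW.
  by rewrite conv_list_shift; apply: conv_list_simple.
have dr : (conv_list (c :: l))^`().[y] != 0 by exact: conv_list_simple.
move: W; rewrite /wronskian !hornerE ry mul0r subr0 => W.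
rewrite (_ : _ / _ = (conv_list (c :: l))^`().[y] * (conv_list l).[y] /
    (conv_list (c :: l))^`().[y] ^+ 2).
  by rewrite divr_gt0 // exprn_even_gt0.
by field.
Qed.

Lemma conv_list_rpoly l : (size l <= n)%N ->
  exists2 xi : 'rV[R]_(size l), conv_list l = rpoly xi & injective (xi 0).
Proof.
move=> sl; have [fm sf] := conv_list_monic l.
have [xi _ xiE] := exists_sorted_rpoly (realrooted_conv_list sl) fm sf.
exists xi => //; apply: rpoly_injective => y; rewrite -xiE; exact: conv_list_simple.
Qed.

(* With r, f, g the convolutions of the successively shorter lists, the residues A
   of f/r and B of g/f are positive; expanding g/r = (g/f)(f/r), the sum over [k] of
   [A k / (gam k - xi m)] vanishes at each root [xi m] of f, so only the variation
   of [w] across [xi m] contributes. *)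
Lemma residue_sum_gt0 l ci cj (gam : 'rV[R]_n) (w : 'I_n -> R) :
  size l = n.-2 -> (1 < n)%N -> conv_list [:: ci, cj & l] = rpoly gam ->
  increasing gam -> (forall i j : 'I_n, (i <= j)%N -> w i <= w j) ->
  ~ (forall i j, w i = w j) ->
  0 < \sum_k w k * ((conv_list l).[gam 0 k] / (rpoly gam)^`().[gam 0 k]).
Proof.
move=> sl n1 rE gi wS wN; set r := rpoly gam in rE *.
set f := conv_list (cj :: l); set g := conv_list l.
have sl1 : size (cj :: l) = n.-1 by rewrite /= sl; lia.
have sl1n : (size (cj :: l) < n)%N by rewrite sl1; lia.
have [xi fE xiI] := conv_list_rpoly (ltnW sl1n).
have rg k : r.[gam 0 k] = 0 by rewrite /r horner_rpoly (bigD1 k) //= subrr mul0r.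
have fx m : f.[xi 0 m] = 0 by rewrite /f fE horner_rpoly (bigD1 m) //= subrr mul0r.
pose A k := f.[gam 0 k] / r^`().[gam 0 k].
have A0 k : 0 < A k.
  by rewrite /A -rE; apply: residue_gt0 => //; rewrite rE; exact: rg.
pose B m := g.[xi 0 m] / f^`().[xi 0 m].
have B0 m : 0 < B m.
  apply: residue_gt0; last exact: fx.
  by rewrite sl; lia.
have fg k : f.[gam 0 k] != 0.
  by apply: contraTneq (A0 k) => E; rewrite /A E mul0r ltxx.
have gx k m : gam 0 k != xi 0 m by apply: contra_neq (fg k) => ->; exact: fx.
have gI := increasing_inj gi.
have sg : (size g <= size (cj :: l))%N.
  by have [_ ->] := conv_list_monic l.
have gE k : g.[gam 0 k] = f.[gam 0 k] * \sum_m B m / (gam 0 k - xi 0 m).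
  by rewrite (partial_fractions xiI sg (gx k)) -fE.
have sf : (size f <= n)%N.
  by have [_ ->] := conv_list_monic (cj :: l).
(* The partial fractions of $f/r$, evaluated at the zero [xi m] of $f$ with the signs reversed. *)
have S0 m : \sum_k A k / (gam 0 k - xi 0 m) = 0.
  have xg k : xi 0 m != gam 0 k by rewrite eq_sym.
  have := partial_fractions gI sf xg; rewrite fx => /esym/eqP.
  rewrite mulf_eq0 horner_rpoly => /orP[|/eqP H].
    rewrite prodf_seq_eq0 => /hasP[k _ /=]; rewrite subr_eq0 => /eqP E.
    by have := xg k; rewrite E eqxx.
  transitivity (- \sum_k A k / (xi 0 m - gam 0 k)); last by rewrite [X in - X]H oppr0.
  rewrite -sumrN; apply: eq_bigr => k _.
  by rewrite -(opprB (xi 0 m)) invrN mulrN.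
have -> : \sum_k w k * (g.[gam 0 k] / r^`().[gam 0 k]) =
    \sum_m B m * \sum_k w k * (A k / (gam 0 k - xi 0 m)).
  under [RHS]eq_bigr do rewrite mulr_sumr.
  rewrite exchange_big; apply: eq_bigr => k _ /=; rewrite gE.
  rewrite mulr_sumr mulr_suml mulr_sumr; apply: eq_bigr => m _.
  by rewrite /A; ring.
have T m : 0 < B m * \sum_k w k * (A k / (gam 0 k - xi 0 m)).
  rewrite mulr_gt0 //; apply: weighted_sum_gt0 => //.
  - exact: ltnW.
  - exact: increasing_le.
have m0 : (0 < size (cj :: l))%N by [].
rewrite (bigD1 (Ordinal m0)) //= ltr_wpDr // sumr_ge0 // => m _; exact/ltW.
Qed.
End Residues.

(** * The transpose of the differential on increasing vectors *)

Section Transfer.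
Variables (R : realType) (n : nat) (x : 'rV[R]_(n + n)).
Hypothesis n_gt1 : (1 < n)%N.
Local Notation alpha := (lsubmx x : 'rV[R]_n).
Local Notation beta := (rsubmx x : 'rV[R]_n).
Hypothesis alphaI : injective (alpha 0).
Hypothesis betaI : injective (beta 0).

(** A test direction: pairing a vector with it reads off the gap between entries [j] and [i] of the
    left half, as in [dot_spread]. *)
Definition spread (i j : 'I_n) : 'rV[R]_(n + n) :=
  row_mx (delta_mx 0 j - delta_mx 0 i) 0.

Definition others (i j : 'I_n) : seq R :=
  [seq alpha 0 m | m <- enum 'I_n & (m != i) && (m != j)].

Lemma rpoly_split (a : 'rV[R]_n) i j : i != j -> rpoly a =
  ('X - (a 0 i)%:P) * (('X - (a 0 j)%:P) *
    \prod_(m <- enum 'I_n | (m != i) && (m != j)) ('X - (a 0 m)%:P)).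
Proof.
move=> ij; rewrite /rpoly (bigD1 i) //= (bigD1 j) 1?eq_sym //=.
by rewrite [X in _ = _ * (_ * X)]big_enum_cond.
Qed.

Lemma convp_spread i j s : i != j -> convp (x + s *: spread i j) =
  conv_list beta [:: alpha 0 i - s, alpha 0 j + s & others i j].
Proof.
move=> ij; rewrite convpE /conv_list.
have -> : rsubmx (x + s *: spread i j) = beta.
  by rewrite linearD linearZ /= row_mxKr scaler0 addr0.
congr fconv; rewrite (rpoly_split _ ij) !big_cons /others big_map big_filter.
have E m : (lsubmx (x + s *: spread i j) : 'rV_n) 0 m =
    alpha 0 m + s * ((m == j)%:R - (m == i)%:R).
  by rewrite linearD linearZ /= row_mxKl !mxE eqxx.
rewrite !E !eqxx (negPf ij) [j == i]eq_sym (negPf ij).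
rewrite mulrBr mulr0 mulr1 sub0r subr0 mulr1; congr (_ * (_ * _)).
apply: eq_bigr => m /andP[mi mj]; rewrite E (negPf mi) (negPf mj).
by rewrite subrr mulr0 addr0.
Qed.

(** The two moved roots keep their sum, so their quadratic factor changes only in its constant term,
    which leaves a multiple of the convolution of the remaining list. *)
Lemma conv_list_spread (b : 'rV[R]_n) l ci cj s :
  conv_list b [:: ci - s, cj + s & l] =
  conv_list b [:: ci, cj & l] - (s * (cj - ci) + s ^+ 2) *: conv_list b l.
Proof.
rewrite /conv_list !big_cons -scaleNr -fconvZl -fconvDl; congr fconv.
rewrite -mul_polyC polyCN !polyCD polyCN polyCM polyCD polyCN [(s ^+ 2)%:P]rmorphXn /=.
ring.
Qed.

(** In [roots_of_increment] the polynomial value at the old root is $-(hd+h^2)\,g(c)$ by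
    [conv_list_spread]. Dividing by $h$ and letting the remaining roots return to their places gives
    the derivative. *)
Lemma tangent_spread i j k : i != j ->
  tangent x (spread i j) 0 k = (alpha 0 j - alpha 0 i) *
   ((conv_list beta (others i j)).[roots_of x 0 k] / (rpoly (roots_of x))^`().[roots_of x 0 k]).
Proof.
move=> ij; have gx := increasing_base alphaI.
set g := conv_list _ _; set c := roots_of x 0 k; set d := alpha 0 j - alpha 0 i.
rewrite (tangentE alphaI) /root_speed /derive.
pose Q (h : R) := \prod_(l < n | l != k) (c - root_curve x (spread i j) l h).
have cc : {for (0 : R), continuous (fun h => (d + h) * g.[c] * - - (Q h)^-1)}.
  apply: continuousM.
    apply: continuousM; last exact: cst_continuous.
    by apply: continuousD; [exact: cst_continuous|exact: cvg_id].
  apply: (@continuousN _ _ _ (fun h => - (Q h)^-1)).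
  apply: continuous_prodV => [l|].
    by apply/differentiable_continuous/differentiable_root_curve; rewrite scale0r addr0.
  apply/prodf_neq0 => l lk; rewrite subr_eq0 /root_curve scale0r addr0.
  by apply: contra_neq lk => /(increasing_inj gx).
have -> : d * (g.[c] / (rpoly (roots_of x))^`().[c]) = (d + 0) * g.[c] * - - (Q 0)^-1.
  rewrite addr0 opprK mulrA; congr (_ / _); rewrite deriv_rpoly.
  by apply: eq_bigr => l _; rewrite /root_curve scale0r addr0.
apply/cvg_lim => //.
have /continuous_withinNx := cc; apply: cvg_trans; apply: near_eq_cvg.
have lc : (fun h : R => x + h *: spread i j) @ (0 : R) --> x.
  have : (fun h : R => x + h *: spread i j) @ (0 : R) --> x + 0 *: spread i j.
    exact: (differentiable_continuous (differentiable_line x (spread i j) 0)).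
  by rewrite scale0r addr0.
have H : \forall h \near (0 : R), roots_of (x + h *: spread i j) 0 k = c +
    (convp (x + h *: spread i j)).[c] *
      - (\prod_(l < n | l != k) (c - roots_of (x + h *: spread i j) 0 l))^-1.
  exact: (lc _ (roots_of_increment gx k)).
have H0 := nbhs_dnbhs_neq (0 : R).
apply: filterS2 H0 (nbhs_dnbhs H) => h h0 Hh.
have cE : (conv_list beta [:: alpha 0 i, alpha 0 j & others i j]).[c] = 0.
  have := convp_spread 0 ij; rewrite scale0r !addr0 subr0 => <-.
  by rewrite convp_roots horner_rpoly (bigD1 k) //= subrr mul0r.
rewrite /= (_ : h%:A = h); last exact: mulr1.
rewrite addr0 /root_curve scale0r addr0 -/c Hh.
rewrite convp_spread // conv_list_spread hornerD hornerN hornerZ cE sub0r -/d -/g /Q /root_curve.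
rewrite [c + _]addrC addrK -[h^-1 *: _]/(h^-1 * _).
by set P := (\prod_(l < n | _) _)^-1; field.
Qed.

(** Read through the transpose of the differential: the left half of the image of [w] is strictly
    ordered in the same way as [alpha]. *)
Lemma tangent_spread_gt0 i j (w : 'rV[R]_n) : alpha 0 i < alpha 0 j ->
  (forall i j : 'I_n, (i <= j)%N -> w 0 i <= w 0 j) -> ~ (forall i j, w 0 i = w 0 j) ->
  0 < dot w (tangent x (spread i j)).
Proof.
move=> aij wS wN; have ij : i != j by apply: contraTneq aij => ->; rewrite ltxx.
have gx := increasing_base alphaI.
have sl : size (others i j) = n.-2.
  have /(congr1 (fun p : {poly R} => size p)) := convp_spread 0 ij.
  rewrite scale0r addr0 size_convp; have [_ ->] := conv_list_monic beta
    [:: alpha 0 i - 0, alpha 0 j + 0 & others i j].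
  by move=> /=; lia.
have rE : conv_list beta [:: alpha 0 i, alpha 0 j & others i j] = rpoly (roots_of x).
  have := convp_spread 0 ij; rewrite scale0r !addr0 subr0 => <-; exact: convp_roots.
rewrite /dot; under eq_bigr do rewrite tangent_spread // mulrCA.
rewrite -mulr_sumr mulr_gt0 ?subr_gt0 //.
exact: (residue_sum_gt0 betaI sl n_gt1 rE gx wS wN).
Qed.
End Transfer.

(** * The kernel *)

Section Kernel.
Variables (R : realType) (n : nat) (x : 'rV[R]_(n + n)).
Hypothesis n_gt1 : (1 < n)%N.
Local Notation alpha := (lsubmx x : 'rV[R]_n).
Local Notation beta := (rsubmx x : 'rV[R]_n).
Hypothesis alphaI : injective (alpha 0).
Hypothesis betaI : injective (beta 0).
Implicit Types v y : 'rV[R]_(n + n).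
Local Notation ones := (const_mx 1 : 'rV[R]_n).
Local Notation J := (tangent x).

Definition center_point : 'rV[R]_(n + n) := row_mx (centered alpha) (centered beta).
Local Notation x0 := center_point.

Lemma centered_center : centered_pair x0.
Proof. by rewrite /centered_pair row_mxKl row_mxKr !sum_centered. Qed.

Let mean (a : 'rV[R]_n) : R := (\sum_k a 0 k) / n%:R.

Lemma center_pointE :
  x0 = x + row_mx (- mean alpha *: ones) (- mean beta *: ones).
Proof.
rewrite -[X in X + _](hsubmxK x) add_row_mx /x0 /centered; congr row_mx;
  by rewrite scaleNr.
Qed.

Lemma roots_of_center k : roots_of x0 0 k = roots_of x 0 k - (mean alpha + mean beta).
Proof. by rewrite center_pointE roots_of_shift !mxE mulr1 opprD. Qed.

(** Up to multiples of the all-ones vector in each half, $x+sx_0$ is $(1+s)x$, and scaling by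
    $1+s\ge0$ preserves the order of the roots. *)
Lemma root_curve_center k s : -1 <= s ->
  root_curve x x0 k s = roots_of x 0 k + s * roots_of x0 0 k.
Proof.
move=> s1; rewrite /root_curve.
have -> : x + s *: x0 = (1 + s) *: x +
    row_mx (- (s * mean alpha) *: ones) (- (s * mean beta) *: ones).
  rewrite center_pointE scalerDr addrA scalerDl scale1r scale_row_mx !scalerA.
  by rewrite !mulrN.
rewrite roots_of_shift roots_of_scale; last by lra.
by rewrite roots_of_center !mxE; ring.
Qed.

Lemma tangent_center : J x0 = roots_of x0.
Proof.
apply/rowP => k; rewrite tangentE // /root_speed.
rewrite (@near_eq_derive _ _ _ _ (cst (roots_of x 0 k) + roots_of x0 0 k *: id)).
  have dl : derivable (roots_of x0 0 k *: id : R -> R) 0 1 by apply: derivableZ.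
  by rewrite deriveD // deriveZ // derive_cst derive_id add0r -[_ *: _]/(_ * _) mulr1.
have : \forall s \near (0 : R), -1 < s by apply: lt_nbhsr; lra.
by apply: filterS => s /ltW /root_curve_center ->; rewrite mulrC.
Qed.

Lemma dot_tangent_center : dot (J x0) (J x0) = dot x0 x0.
Proof.
by rewrite tangent_center; case: centered_center => l0 r0; apply: sqr_roots_of.
Qed.

(** The form $|y|^2-|Jy|^2$ is positive semidefinite on centered pairs, so a vector on which it
    vanishes lies in its radical. *)
Lemma tangent_dot v y : centered_pair v -> centered_pair y ->
  dot (J v) (J v) = dot v v -> dot (J v) (J y) = dot v y.
Proof.
move=> vc yc vE; apply/eqP; rewrite -subr_eq0; apply/eqP.
set b := _ - _; set c := dot y y - dot (J y) (J y).
have q t : 0 <= - (2 * t * b) + t ^+ 2 * c.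
  have := tangent_le n_gt1 alphaI betaI (centered_pair_line t vc yc).
  by rewrite tangent_line !dot_line vE /b /c; lra.
have c0 : 0 <= c by have := q 1; have := q (-1); lra.
have c1 : 0 < c + 1 by lra.
(* A nearly minimizing [t]; the added 1 covers the case [c = 0]. *)
have := q (b / (c + 1)).
have -> : - (2 * (b / (c + 1)) * b) + (b / (c + 1)) ^+ 2 * c =
    - (b ^+ 2 * ((c + 2) / (c + 1) ^+ 2)) by field; rewrite gt_eqF.
rewrite oppr_ge0 pmulr_lle0; last by rewrite divr_gt0 ?exprn_gt0 //; lra.
move=> b2; apply/eqP; rewrite -sqrf_eq0; apply/eqP; apply: le_anti.
by rewrite b2 sqr_ge0.
Qed.

Lemma center_neq0 : x0 != 0.
Proof.
apply/eqP => E; have i0 : (0 < n)%N by exact: ltnW.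
have := congr1 (fun y : 'rV[R]_(n + n) =>
  (lsubmx y : 'rV_n) 0 (Ordinal n_gt1) - (lsubmx y : 'rV_n) 0 (Ordinal i0)) E.
rewrite /= row_mxKl linear0 /centered !mxE => H.
by have /alphaI : alpha 0 (Ordinal n_gt1) = alpha 0 (Ordinal i0) by rewrite !mxE; lra.
Qed.

Lemma dot_ge0 m (u : 'rV[R]_m) : 0 <= dot u u.
Proof. by rewrite dot_sqr sumr_ge0 // => i _; rewrite sqr_ge0. Qed.

Lemma centered_spread i j : centered_pair (spread R i j : 'rV[R]_(n + n)).
Proof.
rewrite /centered_pair row_mxKl row_mxKr; split; last by rewrite big1 // => k _; rewrite mxE.
under eq_bigr do rewrite !mxE eqxx /=.
rewrite sumrB (bigD1 j) //= eqxx big1 ?addr0 => [|k /negPf -> //].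
by rewrite (bigD1 i) //= eqxx big1 ?addr0 ?subrr // => k /negPf ->.
Qed.

Lemma dot_spread v i j : dot v (spread R i j) =
  (lsubmx v : 'rV_n) 0 j - (lsubmx v : 'rV_n) 0 i.
Proof.
rewrite /dot big_split_ord /= [X in _ + X]big1 ?addr0 => [|k _]; last first.
  by rewrite row_mxEr mxE mulr0.
under eq_bigr do rewrite row_mxEl !mxE eqxx /= mulrBr.
rewrite sumrB (bigD1 j) //= eqxx mulr1 big1 ?addr0 => [|k /negPf ->]; last by rewrite mulr0.
by rewrite (bigD1 i) //= eqxx mulr1 big1 ?addr0 ?mxE // => k /negPf ->; rewrite mulr0.
Qed.

Lemma tangent_kernel v : centered_pair v -> dot (J v) (J v) = dot v v ->
  exists c, v = c *: x0.
Proof.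
move=> vc vE; have n0 : (0 < n)%N by exact: ltnW.
have gx := increasing_base alphaI; set gam := roots_of x in gx.
pose w := J v; pose rho (p : 'I_n * 'I_n) := (w 0 p.2 - w 0 p.1) / (gam 0 p.2 - gam 0 p.1).
have p01 : ((Ordinal n0, Ordinal n_gt1).1 < (Ordinal n0, Ordinal n_gt1).2)%N by [].
have [[i0 j0] /= ij0 rho_min] := @arg_minP _ _ _ (Ordinal n0, Ordinal n_gt1)
  (fun p : 'I_n * 'I_n => (p.1 < p.2)%N) rho p01.
(* The smallest ratio of gaps: [w - c gamma] is weakly increasing with a tie. *)
set c := rho (i0, j0) in rho_min.
exists c; pose v' := v + (- c) *: x0.
suff : v' = 0 by rewrite /v' scaleNr => /eqP; rewrite subr_eq0 => /eqP.
have vc' : centered_pair v' by apply: centered_pair_line => //; exact: centered_center.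
(* By [tangent_dot] the cross terms agree as well, so combinations of isometric vectors are
   isometric. *)
have vE' : dot (J v') (J v') = dot v' v'.
  rewrite /v' tangent_line !dot_line vE dot_tangent_center.
  by rewrite (tangent_dot vc centered_center vE).
have wE k : J v' 0 k = w 0 k - c * (gam 0 k - (mean alpha + mean beta)).
  by rewrite /v' tangent_line !mxE tangent_center roots_of_center mulNr.
have diff i j : J v' 0 j - J v' 0 i = w 0 j - w 0 i - c * (gam 0 j - gam 0 i).
  by rewrite !wE; ring.
have wS (i j : 'I_n) : (i <= j)%N -> J v' 0 i <= J v' 0 j.
  rewrite leq_eqVlt => /orP[/eqP/val_inj -> //|ij].
  rewrite -subr_ge0 diff subr_ge0 -ler_pdivlMr ?subr_gt0 ?gx //.
  exact: (rho_min (i, j)).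
have tie : J v' 0 i0 = J v' 0 j0.
  apply/esym/eqP; rewrite -subr_eq0 diff /c /rho /= divfK ?subrr //.
  by rewrite subr_eq0 gt_eqF // gx.
(* A constant image has entries summing to 0, since [v'] is centered. It therefore vanishes, and
   [v'] with it by isometry. *)
have [const|nconst] := pselect (forall i j, J v' 0 i = J v' 0 j).
  have s0 : \sum_k J v' 0 k = 0.
    under eq_bigr do rewrite tangentE //.
    by rewrite sum_root_speed //; case: vc' => -> ->; rewrite addr0.
  have z k : J v' 0 k = 0.
    move: s0; under eq_bigr => i _ do rewrite (const i k).
    rewrite sumr_const card_ord => /eqP; rewrite mulrn_eq0.
    by rewrite eqn0Ngt n0 /= => /eqP.
  apply/eqP; rewrite -dot_eq0 -vE' /dot big1 // => k _.
  by rewrite z mul0r.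
(* Isometry moves the pairing of [J v'] with [J (spread i j)] back to [v'], whose left half is thus
   strictly ordered like [alpha]. Then [v'] has simple roots, and [tangent_isometric] excludes the
   tie. *)
have inj : injective ((lsubmx v' : 'rV_n) 0).
  have lt i j : alpha 0 i < alpha 0 j -> (lsubmx v' : 'rV_n) 0 i < (lsubmx v' : 'rV_n) 0 j.
    move=> aij; rewrite -subr_gt0 -dot_spread -(tangent_dot vc' (centered_spread i j) vE').
    exact: tangent_spread_gt0.
  move=> i j E; apply: alphaI; case: (ltgtP (alpha 0 i) (alpha 0 j)) => // /lt; by rewrite E ltxx.
have iv := one_simple_increasing (or_introl inj : one_simple v').
have /(_ i0 j0 tie) E := tangent_isometric n_gt1 alphaI betaI vc' iv vE'.
by move: ij0; rewrite E ltnn.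
Qed.
End Kernel.

(** * Operator norm, multiplicity and kernel on the centered space *)

Section Assembly.
Variables (R : realType) (n : nat) (alpha beta : 'rV[R]_n).
Hypothesis n_gt1 : (1 < n)%N.
Hypothesis alphaI : injective (fun i : 'I_n => alpha 0 i).
Hypothesis betaI : injective (fun i : 'I_n => beta 0 i).

Local Notation x := (row_mx alpha beta).
Local Notation x0 := (center_point x).
Local Notation V := (calV R n).
Local Notation JV := (lrestr (DOmega alpha beta) V).

Let aI : injective ((lsubmx x : 'rV[R]_n) 0).
Proof. by rewrite row_mxKl. Qed.
Let bI : injective ((rsubmx x : 'rV[R]_n) 0).
Proof. by rewrite row_mxKr. Qed.

Lemma memv_calV (v : 'rV[R]_(n + n)) : v \in V <-> centered_pair v.
Proof.
have E (a : 'rV[R]_n) : dot a (const_mx 1) = \sum_k a 0 k.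
  by apply: eq_bigr => k _; rewrite mxE mulr1.
rewrite -{1}(hsubmxK v) /calV memv_dsumv !memv_perp !E /centered_pair.
by split=> [/andP[/eqP -> /eqP ->]|[-> ->]]; rewrite ?eqxx.
Qed.

Lemma vsval_centered (u : subvs_of V) : centered_pair (vsval u).
Proof. by apply/memv_calV; exact: subvsP. Qed.

Lemma lrestr_DOmegaE u : JV u = tangent x (vsval u).
Proof. by rewrite /lrestr comp_lfunE lfunE /= /DOmega lfunE. Qed.

Lemma center_in : x0 \in V.
Proof. by apply/memv_calV; exact: centered_center. Qed.

Definition center_sub : subvs_of V := Subvs center_in.

Lemma center_sub_neq0 : center_sub != 0.
Proof.
apply/eqP => E; have /eqP := center_neq0 n_gt1 aI; apply.
by rewrite -[LHS]/(vsval center_sub) E linear0.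
Qed.

Lemma vsval_center c : vsval (c *: center_sub) = c *: x0.
Proof. by rewrite linearZ. Qed.

(** Pairing $u=J^*Ju$ with $u$ shows that $u$ is isometric, so [tangent_kernel] applies. Conversely
    $d=x_0-J^*Jx_0$ satisfies $|d|^2=\langle d,x_0\rangle-\langle Jd,Jx_0\rangle=0$ by
    [tangent_dot]. *)
Lemma ker_line : (lker (\1%VF - (adjoint JV \o JV)%VF) = <[center_sub]>)%VS.
Proof.
apply/vspaceP => u; rewrite memv_ker add_lfunE opp_lfunE comp_lfunE id_lfunE subr_eq0.
apply/eqP/vlineP => [uE|[c ->]].
  have uu : dot (tangent x (vsval u)) (tangent x (vsval u)) = dot (vsval u) (vsval u).
    by rewrite -lrestr_DOmegaE adjointP -uE.
  have [c cE] := tangent_kernel n_gt1 aI bI (vsval_centered u) uu.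
  by exists c; apply: val_inj; exact: etrans cE (esym (vsval_center c)).
suff H : center_sub = adjoint JV (JV center_sub) by rewrite !linearZ /= -H.
apply/eqP; rewrite -subr_eq0; set d := center_sub - _.
suff d0 : vsval d = 0 by apply/eqP/val_inj; rewrite -[LHS]/(vsval d) d0 -[RHS]/(vsval 0) linear0.
apply/eqP; rewrite -dot_eq0.
have dE : vsval d = x0 - vsval (adjoint JV (JV center_sub)) by rewrite linearB.
have dB (a b e : 'rV[R]_(n + n)) : dot a (b - e) = dot a b - dot a e.
  by rewrite -scaleN1r addrC dot_linear scaleN1r addrC.
rewrite [X in dot _ X]dE dB -adjointP !lrestr_DOmegaE dotC.
rewrite [dot (tangent _ _) _]dotC (tangent_dot n_gt1 aI bI) ?subrr //.
- exact: centered_center.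
- exact: vsval_centered.
exact: dot_tangent_center.
Qed.

Lemma enorm_center_gt0 : 0 < enorm x0.
Proof.
rewrite /enorm sqrtr_gt0 lt_neqAle dot_ge0 andbT eq_sym dot_eq0.
exact: center_neq0.
Qed.

Lemma opnormE : opnorm JV = 1.
Proof.
rewrite /opnorm; set S := [set _ | _ in _].
have ub : ubound S 1.
  move=> _ [u /= u1 <-]; rewrite lrestr_DOmegaE; apply: le_trans u1.
  by rewrite /enorm ler_wsqrtr // tangent_le //; exact: vsval_centered.
have S1 : S 1.
  have dotZ m (a : 'rV[R]_m) e : dot (e *: a) (e *: a) = e ^+ 2 * dot a a.
    by rewrite /dot mulr_sumr; apply: eq_bigr => i _; rewrite !mxE; ring.
  have nZ : enorm ((enorm x0)^-1 *: x0) = 1.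
    rewrite {1}/enorm dotZ -[dot x0 x0]sqr_sqrtr ?dot_ge0 // -/(enorm x0).
    by rewrite -exprMn mulVf ?gt_eqF ?enorm_center_gt0 // expr1n sqrtr1.
  exists ((enorm x0)^-1 *: center_sub).
    suff : enorm (vsval ((enorm x0)^-1 *: center_sub)) <= 1 by [].
    by rewrite vsval_center nZ.
  rewrite lrestr_DOmegaE vsval_center -[RHS]nZ /enorm /tangent linearZ /= -/(tangent x x0).
  by rewrite !dotZ dot_tangent_center.
apply/eqP; rewrite eq_le ge_sup //=; last by exists 1.
by apply: ub_le_sup => //; exists 1.
Qed.
End Assembly.

Theorem corollary1p3 (R : realType) (n : nat) (hn : (2 <= n)%N)
    (alpha beta : 'rV[R]_n)
    (halpha : injective (fun i : 'I_n => alpha 0 i))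
    (hbeta : injective (fun i : 'I_n => beta 0 i)) :
  let JV := lrestr (DOmega alpha beta) (calV R n) in
  [/\ opnorm JV = 1,
      singular_mult JV 1 = 1%N &
      (linfun vsval @: lker (\1%VF - (adjoint JV \o JV)%VF))%VS
        = <[row_mx (centered alpha) (centered beta)]>%VS].
Proof.
move=> JV; split.
- exact: opnormE.
- rewrite /singular_mult /passmx.leigenspace expr1n scale1r.
  (* The eigenspace is the kernel of $J^*J-1$, the opposite of the operator in [ker_line]. *)
  rewrite -[(_ - _)%VF]opprB.
  have -> : lker (- (\1 - (adjoint JV \o JV)))%VF = lker (\1 - (adjoint JV \o JV))%VF.
    by apply/vspaceP => u; rewrite !memv_ker opp_lfunE oppr_eq0.
  by rewrite ker_line // dim_vline center_sub_neq0.
rewrite ker_line // limg_line lfunE /=.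
by rewrite /center_point row_mxKl row_mxKr.
Qed.
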